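(* Let $f,g_1,\ldots,g_m\colon\mathbb{R}^n\to\mathbb{R}$ be polynomial functions with $m+1\le n$, let $$S:=\{x\in\mathbb{R}^n\mid g_1(x)\le0,\ldots,g_m(x)\le0\},\qquad \psi(x):=\max\{g_1(x),\ldots,g_m(x),0\},$$ and assume that $S\neq\emptyset$ and $\inf_{x\in S}f(x)$ is finite. Let the mapping $(f,g_1,\ldots,g_m)\colon\mathbb{R}^n\to\mathbb{R}^{m+1}$ be convenient and non-degenerate at infinity. If the (MFCQ) holds at every global minimum of $f$ on $S$, then the following properties are equivalent: (i) there exists a constant $c_*>0$ such that for all $c>c_*$, $$\inf_{x\in S}f(x)=\inf_{x\in\mathbb{R}^n}\{f(x)+c\,\psi(x)\}>-\infty;$$ (ii) there exists a constant $c_*>0$ such that $\inf_{x\in\mathbb{R}^n}\{f(x)+c_*\psi(x)\}>-\infty$. When these equivalent properties hold, one has moreover (with $c_*$ as in (i)) for all $c>c_*$ that $$\mathrm{argmin}_S f(x)=\mathrm{argmin}_{\mathbb{R}^n}\{f(x)+c\,\psi(x)\}\ne\emptyset.$$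
   Context: The (MFCQ) (Mangasarian–Fromovitz constraint qualification) holds at $x\in S$ if there is no unit vector $w=(w_1,\ldots,w_m)\in N_{\mathbb{R}_-^m}(g(x))$ with $\sum_{i=1}^m w_i\nabla g_i(x)=0$, where $g=(g_1,\ldots,g_m)$, $\mathbb{R}_-=(-\infty,0]$ and $N_{\mathbb{R}_-^m}(g(x))=\{w\in\mathbb{R}^m\mid w_i\ge0,\ w_ig_i(x)=0,\ i=1,\ldots,m\}$ is the normal cone to $\mathbb{R}_-^m$ at $g(x)$. Let $\mathbb{R}^*:=\mathbb{R}\setminus\{0\}$ and let $\mathbb{Z}_+$ be the set of non-negative integers. For a polynomial $h=\sum_\kappa c_\kappa x^\kappa$ on $\mathbb{R}^n$ (where $x^\kappa=x_1^{\kappa_1}\cdots x_n^{\kappa_n}$, $\kappa\in\mathbb{Z}_+^n$), its support is $\mathrm{supp}(h):=\{\kappa\mid c_\kappa\ne0\}$ and its Newton polyhedron (at infinity) $\Gamma(h)$ is the convex hull in $\mathbb{R}^n$ of $\mathrm{supp}(h)$. The polynomial $h$ is convenient if $\Gamma(h)$ intersects each coordinate axis at a point different from the origin. For $q\in\mathbb{R}^n$ put $$d(q,\Gamma):=\min\{\langle q,\kappa\rangle\mid\kappa\in\Gamma\},\qquad \Delta(q,\Gamma):=\{\kappa\in\Gamma\mid\langle q,\kappa\rangle=d(q,\Gamma)\},$$ and for a face $\Delta$ of $\Gamma(h)$ put $h_\Delta(x):=\sum_{\kappa\in\Delta}c_\kappa x^\kappa$. Let $F=(f_1,\ldots,f_p)\colon\mathbb{R}^n\to\mathbb{R}^p$,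 $1\le p\le n$, be a polynomial mapping. $F$ is convenient if all $f_i$ are convenient. $F$ is Khovanskii non-degenerate at infinity if for any $q\in\mathbb{R}^n$ with $d(q,\Gamma(f_i))<0$ for $i=1,\ldots,p$, there are no $x\in(\mathbb{R}^* )^n$ and $\lambda\in(\mathbb{R}^* )^p$ such that $f_{i,\Delta_i}(x)=0$ for $i=1,\ldots,p$ and $\sum_{i=1}^p\lambda_i\nabla f_{i,\Delta_i}(x)=0$, where $\Delta_i:=\Delta(q,\Gamma(f_i))$ and $f_{i,\Delta_i}:=(f_i)_{\Delta_i}$. $F$ is non-degenerate at infinity if for each $k$-tuple $1\le i_1<\cdots<i_k\le p$ the mapping $(f_{i_1},\ldots,f_{i_k})\colon\mathbb{R}^n\to\mathbb{R}^k$ is Khovanskii non-degenerate at infinity. $\mathrm{argmin}$ denotes the set of global minimizers on the indicated set. *)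

(* Defs.v *)
From HB Require Import structures.
From mathcomp Require Import all_boot all_order all_algebra.
From mathcomp Require Import all_classical all_reals interval_inference.
From mathcomp Require Import ereal convex.
(* [mpoly] declares at level 2 notations that are incompatible with those of
   [constructive_ereal], so it is imported without its notations. *)
From mathcomp Require Import -(notations) mpoly.

Set Implicit Arguments.
Unset Strict Implicit.
Unset Printing Implicit Defensive.

Import Order.TTheory GRing.Theory Num.Theory.
Local Open Scope classical_set_scope.
Local Open Scope ring_scope.

Notation "{ 'mpoly' T [ n ] }" := (mpoly n T)
  (at level 0, T, n at level 2, format "{ 'mpoly'  T [ n ] }").

Section Polynomials.
Variables (R : realType) (n : nat).
Implicit Types (h : {mpoly R[n]}) (x q : 'rV[R]_n).

Definition peval h x : R := meval (x 0) h.

Definition gradient h x : 'rV[R]_n := \row_j peval (mderiv j h) x.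

Definition dotv (u v : 'rV[R]_n) : R := \sum_j u 0 j * v 0 j.

Definition expvec (k : multinom n) : 'rV[R]_n := \row_j (k j)%:R.

Definition convex_hull (A : set 'rV[R]_n) : set 'rV[R]_n :=
  \bigcap_(C in [set C : set 'rV[R]_n | convex_set C /\ A `<=` C]) C.

(* [msupp h] is the list of the exponents of the nonzero coefficients of [h]. *)
Definition newton h : set 'rV[R]_n := convex_hull (expvec @` [set` msupp h]).

(* A nonzero multiple of the [j]-th unit vector is a point of the [j]-th
   coordinate axis other than the origin. *)
Definition convenient_poly h : Prop :=
  forall j : 'I_n, exists2 t : R, t != 0 & newton h (t *: delta_mx 0 j).

(* The infimum is a minimum on the Newton polyhedron of a nonzero polynomial
   (see [newton_min]). On the empty set it is [0], so that the zero polynomial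
   never satisfies [dmin q (newton h) < 0]. *)
Definition dmin q (G : set 'rV[R]_n) : R := inf [set dotv q k | k in G].

Definition face q (G : set 'rV[R]_n) : set 'rV[R]_n :=
  [set k | G k /\ dotv q k = dmin q G].

Definition face_poly h (D : set 'rV[R]_n) : {mpoly R[n]} :=
  \sum_(k <- msupp h | `[< D (expvec k) >]) mcoeff k h *: mpolyX R k.

Lemma dotvDr q (u v : 'rV[R]_n) : dotv q (u + v) = dotv q u + dotv q v.
Proof. by rewrite -big_split; apply: eq_bigr => j _; rewrite mxE mulrDr. Qed.

Lemma dotvZr q (a : R) (u : 'rV[R]_n) : dotv q (a *: u) = a * dotv q u.
Proof.
by rewrite /dotv mulr_sumr; apply: eq_bigr => j _; rewrite mxE mulrCA.
Qed.

Lemma newton_min h q : h != 0 ->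
  exists2 k, newton h k &
    dotv q k = dmin q (newton h) /\
    forall k', newton h k' -> dmin q (newton h) <= dotv q k'.
Proof.
move=> h0.
have [k0 k0h kmin] : exists2 k, k \in msupp h &
    forall k', k' \in msupp h -> dotv q (expvec k) <= dotv q (expvec k').
  have : msupp h != [::] by rewrite msupp_eq0.
  elim: (msupp h) => [//|a [|b s] IH _].
    by exists a => [|k']; rewrite ?mem_seq1 // => /eqP->.
  have [//|k ks kle] := IH.
  have [ak|ka] := leP (dotv q (expvec a)) (dotv q (expvec k)).
    exists a; first by rewrite mem_head.
    by move=> k'; rewrite in_cons => /predU1P[->//|/kle]; apply: le_trans.
  exists k; first by rewrite in_cons ks orbT.
  by move=> k'; rewrite in_cons => /predU1P[->|/kle//]; apply: ltW.
have Nk0 : newton h (expvec k0) by move=> C [_]; apply; exists k0.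
have lb k' : newton h k' -> dotv q (expvec k0) <= dotv q k'.
  move/(_ [set v | dotv q (expvec k0) <= dotv q v]); apply.
  split=> [x y t|_ [k ks <-]]; last exact: kmin.
  rewrite !inE /= => qx qy.
  rewrite dotvDr !dotvZr.
  rewrite -[leLHS](mul1r _) -[X in X * _](subrK (t%:num)) mulrDl addrC.
  by apply: lerD; apply: ler_wpM2l => //; rewrite subr_ge0 le1.
have dE : dmin q (newton h) = dotv q (expvec k0).
  apply/eqP; rewrite eq_le; apply/andP; split.
    apply: ge_inf; last by exists (expvec k0).
    by exists (dotv q (expvec k0)) => _ [k Nk <-]; apply: lb.
  apply: lb_le_inf; first by exists (dotv q (expvec k0)), (expvec k0).
  by move=> _ [k Nk <-]; apply: lb.
by exists (expvec k0) => //; rewrite dE; split.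
Qed.

End Polynomials.

Section Mappings.
Variables (R : realType) (n p : nat).
Implicit Types (F : 'I_p -> {mpoly R[n]}).

Definition convenient F : Prop := forall i, convenient_poly (F i).

Definition khovanskii_nondegenerate F : Prop :=
  forall q : 'rV[R]_n, (forall i, dmin q (newton (F i)) < 0) ->
  let FD i := face_poly (F i) (face q (newton (F i))) in
  ~ exists (x : 'rV[R]_n) (lam : 'rV[R]_p),
      [/\ forall j, x 0 j != 0,
          forall i, lam 0 i != 0,
          forall i, peval (FD i) x = 0 &
          \sum_i lam 0 i *: gradient (FD i) x = 0].

End Mappings.

(* The tuples are nonempty: the empty mapping is not Khovanskii non-degenerate. *)
Definition nondegenerate_at_infinity (R : realType) (n p : nat)
    (F : 'I_p -> {mpoly R[n]}) : Prop :=
  forall (k : nat) (s : 'I_k -> 'I_p), (0 < k)%N ->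
    (forall a b : 'I_k, (a < b)%N -> (s a < s b)%N) ->
    khovanskii_nondegenerate (fun a => F (s a)).

Section Optimization.
Variables (R : realType) (n m : nat).
Implicit Types (f : {mpoly R[n]}) (g : 'I_m -> {mpoly R[n]}).

(* The mapping (f, g_1, ..., g_m). *)
Definition fcons f g : 'I_m.+1 -> {mpoly R[n]} :=
  fun i => if unlift ord0 i is Some j then g j else f.

Definition feasible g : set 'rV[R]_n := [set x | forall i, peval (g i) x <= 0].

Definition psi g (x : 'rV[R]_n) : R := \big[Num.max/0]_(i < m) peval (g i) x.

Definition penalized f g (c : R) (x : 'rV[R]_n) : R := peval f x + c * psi g x.

(* The normal cone to the nonpositive orthant at the point [y]. *)
Definition normal_cone (y : 'rV[R]_m) : set 'rV[R]_m :=
  [set w | forall i, 0 <= w 0 i /\ w 0 i * y 0 i = 0].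

(* "Unit" refers to the Euclidean norm; the library norm on row vectors is the
   sup norm. *)
Definition MFCQ g (x : 'rV[R]_n) : Prop :=
  ~ exists w : 'rV[R]_m,
      [/\ \sum_i w 0 i ^+ 2 = 1,
          normal_cone (\row_i peval (g i) x) w &
          \sum_i w 0 i *: gradient (g i) x = 0].

Definition inf_on (A : set 'rV[R]_n) (h : 'rV[R]_n -> R) : \bar R :=
  ereal_inf [set (h x)%:E | x in A].

Definition argmin (A : set 'rV[R]_n) (h : 'rV[R]_n -> R) : set 'rV[R]_n :=
  [set x | A x /\ forall y, A y -> h x <= h y].

End Optimization.

(* Main.v *)
Require Import Defs.
From mathcomp Require Import all_boot all_order all_algebra.
From mathcomp Require Import all_classical all_reals ereal.
From mathcomp Require Import -(notations) mpoly.
From mathcomp Require Import normedtype sequences.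
From mathcomp Require Import derive realfun exp convex.
From mathcomp Require Import ring lra.

Set Implicit Arguments.
Unset Strict Implicit.
Unset Printing Implicit Defensive.

Import Order.TTheory GRing.Theory Num.Theory.
Import numFieldNormedType.Exports.
Local Open Scope classical_set_scope.
Local Open Scope ring_scope.

(** The whole argument rests on one boundedness statement,
    [bounded_multipliers_bounded_points]: if [F] is convenient and
    non-degenerate at infinity, and if one multiplier is normalized to [1],
    then the points [x] that carry nonnegative multipliers [lam] with all
    [lam i * F i (x)] and all [x_l * d_l (sum_i lam i * F i) (x)] bounded by [B]
    lie in a fixed box.

    It is proved by contradiction along an unbounded family of such points.
    Instead of selecting an analytic curve, one works along an ultrafilter,
    where every bounded real function converges. Take the logarithmic vector
    [v = (- ln |x_j|)_j]. The differences [<v, k - k0>], where [k0] is the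
    dominant exponent of [F i], either stay bounded or tend to infinity.
    Linear algebra ([bounded_representative]) yields a bounded [w] on which the
    bounded differences take the same values, so that [q = v - w] annihilates
    exactly them: [q] cuts out a fixed face of each Newton polyhedron, and
    [x_j * expR q_j] converges to a point [y] with nonzero coordinates. After
    multiplication by [expR d_i], with [d_i] the minimum of [q] on the
    polyhedron of [F i], both [F i] and [x_l * d_l (F i)] converge to the values
    at [y] for the face polynomial ([toric_limit]). Convenience makes every
    [d_i] tend to minus infinity, so the weights [lam i * expR (- d_i)] blow up;
    dividing by the largest one, all the bounded quantities vanish in the limit,
    and what remains is a nontrivial relation between the gradients at [y] of
    the face polynomials that vanish there. Non-degeneracy of the subfamily with
    nonzero limit weights excludes it ([toric_obstruction]).

    The multipliers come from a smooth coercive problem. The maximum [psi] may be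
    replaced by the sum of the positive parts, as each dominates a constant
    multiple of the other. The positive part is then replaced by
    [(t + sqrt (t^2 + d^2)) / 2], and [eps * |x|^2] is added. The result has a
    global minimizer, whose stationarity equation reads
    [d_l f + sum_i lam i * d_l (g i) = - 2 * eps * x_l]: multiplied by [x_l], its
    right-hand side is controlled by the minimal value, and so are [f] and
    [lam i * g i]. Hence near-optimal stationary points of the penalized problem
    stay in one box for all large penalty weights ([stationary_points_below]).

    Both conclusions follow by passing to the limit. With a fixed weight, the
    limit point minimizes the penalized function ([penalty_attained]). If
    exactness failed for arbitrarily large weights, the stationary points could
    be taken infeasible and with values below the constrained infimum; the limit
    point is then a global minimizer on [S], the sum of the multipliers tends to
    infinity, and the normalized multipliers converge to a vector forbidden by
    the Mangasarian-Fromovitz condition ([exact_for_large_weights]). *)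

(** * Limits along an ultrafilter *)

Lemma ultra_not (T : Type) (U : set_system T) (P : set T) :
  UltraFilter U -> ~ (\forall t \near U, P t) -> \forall t \near U, ~ P t.
Proof. by move=> UU nP; have [//|] := in_ultra_setVsetC P UU. Qed.

(** An ultrafilter decides a finite choice: this replaces the repeated extraction
    of subsequences on which some index is constant. *)
Lemma ultra_pick (T : Type) (I : eqType) (U : set_system T) (s : seq I)
    (P : I -> T -> Prop) : UltraFilter U ->
  (\forall t \near U, exists2 i, i \in s & P i t) ->
  exists2 i, i \in s & \forall t \near U, P i t.
Proof.
move=> UU; elim: s => [|a s IH] Us.
  by have /filter_ex[t []] := Us.
have [Pa|/(ultra_not UU) nPa] := pselect (\forall t \near U, P a t).
  by exists a; rewrite ?mem_head.
have [|i is_ Pi] := IH.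
  apply: filterS2 nPa Us => t nPa [i]; rewrite in_cons => /predU1P[->//|is_ Pi].
  by exists i.
by exists i => //; rewrite in_cons is_ orbT.
Qed.

Lemma ultra_bounded_cvg (T : Type) (R : realType) (U : set_system T)
    (u : T -> R) (a b : R) : UltraFilter U ->
  (\forall t \near U, a <= u t <= b) -> exists2 l, a <= l <= b & u t @[t --> U] --> l.
Proof.
move=> UU ub.
have /(_ (u @ U)) := @segment_compact R a b.
case=> [|l [lab cl]].
  by apply: filterS ub => t utab; rewrite /= in_itv.
exists l; first by move: lab; rewrite /= in_itv.
move=> B lB; have [//|] := in_ultra_setVsetC (u @^-1` B) UU.
move=> UB.
by have [x []] := cl (~` B) B UB lB.
Qed.

Lemma cvgr_sum_seq (T : Type) (R : realType) (U : set_system T) (I : eqType)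
    (s : seq I) (u : I -> T -> R) (l : I -> R) : Filter U ->
  (forall i, i \in s -> u i t @[t --> U] --> l i) ->
  (\sum_(i <- s) u i t) @[t --> U] --> \sum_(i <- s) l i.
Proof.
move=> FU; elim: s => [|i s IH] ul.
  by under eq_fun do rewrite big_nil; rewrite big_nil; apply: cvg_cst.
under eq_fun do rewrite big_cons; rewrite big_cons.
apply: cvgD; first by apply: ul; rewrite mem_head.
by apply: IH => j js; apply: ul; rewrite in_cons js orbT.
Qed.

Lemma cvgr_prod_seq (T : Type) (R : realType) (U : set_system T) (I : Type)
    (s : seq I) (u : I -> T -> R) (l : I -> R) : Filter U ->
  (forall i, u i t @[t --> U] --> l i) ->
  (\prod_(i <- s) u i t) @[t --> U] --> \prod_(i <- s) l i.
Proof.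
move=> FU ul; elim: s => [|i s IH].
  by under eq_fun do rewrite big_nil; rewrite big_nil; apply: cvg_cst.
under eq_fun do rewrite big_cons; rewrite big_cons.
by apply: cvgM => //; apply: ul.
Qed.

Lemma cvgrX (T : Type) (R : realType) (U : set_system T) (u : T -> R) (l : R)
    (k : nat) : Filter U ->
  u t @[t --> U] --> l -> (u t ^+ k) @[t --> U] --> l ^+ k.
Proof.
move=> FU ul; elim: k => [|k IH].
  by under eq_fun do rewrite expr0; rewrite expr0; apply: cvg_cst.
by under eq_fun do rewrite exprS; rewrite exprS; apply: cvgM.
Qed.

Lemma peval_cvg (T : Type) (R : realType) (n : nat) (U : set_system T)
    (h : {mpoly R[n]}) (x : T -> 'rV[R]_n) (y : 'rV[R]_n) : Filter U ->
  (forall j, x t 0 j @[t --> U] --> y 0 j) ->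
  peval h (x t) @[t --> U] --> peval h y.
Proof.
move=> FU xy; rewrite /peval; under eq_fun do rewrite mevalE; rewrite mevalE.
apply: cvgr_sum_seq => m _; apply: cvgM; first exact: cvg_cst.
by apply: cvgr_prod_seq => j; apply: cvgrX.
Qed.

(** * Newton polyhedra and faces *)

Section Newton.
Variables (R : realType) (n : nat).
Implicit Types (h : {mpoly R[n]}) (x q : 'rV[R]_n).

Lemma msupp_newton h k : k \in msupp h -> newton h (expvec R k).
Proof. by move=> kh C [_]; apply; exists k. Qed.

Lemma newton_ge h q (b : R) :
  (forall k, k \in msupp h -> b <= dotv q (expvec R k)) ->
  forall v, newton h v -> b <= dotv q v.
Proof.
move=> hb v /(_ [set v | b <= dotv q v]); apply.
split=> [x y t|_ [k ks <-]]; last exact: hb.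
rewrite !inE /= => qx qy; rewrite dotvDr !dotvZr.
rewrite -[leLHS](mul1r _) -[X in X * _](subrK (t%:num)) mulrDl addrC.
by apply: lerD; apply: ler_wpM2l => //; rewrite subr_ge0 le1.
Qed.

Lemma dmin_newton h q k0 : k0 \in msupp h ->
  (forall k, k \in msupp h -> dotv q (expvec R k0) <= dotv q (expvec R k)) ->
  dmin q (newton h) = dotv q (expvec R k0).
Proof.
move=> k0h kmin; apply/eqP; rewrite eq_le; apply/andP; split.
  apply: ge_inf; last by exists (expvec R k0) => //; apply: msupp_newton.
  by exists (dotv q (expvec R k0)) => _ [k Nk <-]; apply: newton_ge Nk.
apply: lb_le_inf.
  by exists (dotv q (expvec R k0)), (expvec R k0) => //; apply: msupp_newton.
by move=> _ [k Nk <-]; apply: newton_ge Nk.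
Qed.

(** A point of the axis in the convex hull of the support forces an exponent on
    that axis: otherwise each exponent has its [j]-th coordinate bounded by a
    multiple of the sum of its other coordinates, and this convex condition
    excludes the nonzero points of the axis. *)
Lemma convenient_axis h j : convenient_poly h ->
  exists2 k, k \in msupp h & (0 < k j)%N /\ forall l, l != j -> k l = 0%N.
Proof.
move=> /(_ j)[t t0 ht]; apply: contrapT => nk.
pose K : R := \sum_(k <- msupp h) (k j)%:R.
pose S (v : 'rV[R]_n) := \sum_(l | l != j) v 0 l.
have SD u v : S (u + v) = S u + S v.
  by rewrite -big_split; apply: eq_bigr => l _; rewrite mxE.
have SZ a u : S (a *: u) = a * S u.
  by rewrite /S mulr_sumr; apply: eq_bigr => l _; rewrite mxE.
have : 0 <= (t *: delta_mx 0 j : 'rV[R]_n) 0 j <= K * S (t *: delta_mx 0 j).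
  move: ht => /(_ [set v : 'rV[R]_n | 0 <= v 0 j <= K * S v]); apply; split.
    move=> x y a; rewrite !inE /= => /andP[x0 xS] /andP[y0 yS].
    have a0 : 0 <= a%:num by [].
    have a1 : 0 <= 1 - a%:num by rewrite subr_ge0 le1.
    rewrite /conv /= SD !SZ !mxE; apply/andP; split.
      by rewrite addr_ge0 ?mulr_ge0.
    rewrite mulrDr ![K * (_ * _)]mulrCA.
    by apply: lerD; apply: ler_wpM2l.
  move=> _ [k kh <-] /=; rewrite mxE ler0n /=.
  have kK : (k j)%:R <= K.
    rewrite /K (big_rem k) //= lerDl; apply: sumr_ge0 => *; exact: ler0n.
  have [k0|kl] := pselect (forall l, l != j -> k l = 0%N).
    have kj : k j = 0%N.
      apply/eqP; rewrite eqn0Ngt; apply/negP => kj.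
      by apply: nk; exists k.
    rewrite kj /S big1 ?mulr0// => l /k0 kl0; rewrite mxE kl0//.
  have [l] : exists l, ~ (l != j -> k l = 0%N) by apply/existsNP.
  move=> /not_implyP[lj /eqP klN0].
  apply: (le_trans kK); rewrite -[leLHS]mulr1 ler_wpM2l //.
    by apply: le_trans kK; rewrite ler0n.
  rewrite /S (bigD1 l) //= mxE -[leLHS]addr0 lerD ?ler1n ?lt0n //.
  by apply: sumr_ge0 => i _; rewrite mxE ler0n.
have -> : S (t *: delta_mx 0 j) = 0.
  by rewrite /S big1// => l lj; rewrite !mxE eqxx (negbTE lj) mulr0.
rewrite mulr0 !mxE !eqxx mulr1 => /andP[t1 t2].
by move: t0; rewrite (_ : t = 0) ?eqxx//; apply/eqP; rewrite eq_le t1 t2.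
Qed.

Lemma euler_monomial x j (k : multinom n) :
  x 0 j * peval (mderiv j (mpolyX R k)) x = (k j)%:R * peval (mpolyX R k) x.
Proof.
rewrite /peval mderivX mevalZ !mevalX mulrCA.
have [->|kj] := eqVneq (k j) 0%N; first by rewrite !mul0r.
congr (_ * _); rewrite (bigD1 j) //= [in RHS](bigD1 j) //= mulrA.
rewrite mnmBE mnm1E eqxx -exprS subn1 prednK ?lt0n//; congr (_ * _).
by apply: eq_bigr => l lj; rewrite mnmBE mnm1E eq_sym (negbTE lj) subn0.
Qed.

Lemma peval_sum_monomials x (s : seq (multinom n)) P c :
  peval (\sum_(k <- s | P k) c k *: mpolyX R k) x =
  \sum_(k <- s | P k) c k * peval (mpolyX R k) x.
Proof. by rewrite /peval raddf_sum; apply: eq_bigr => k _ /=; rewrite mevalZ. Qed.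

(** Multiplied by the coordinate, the partial derivative has the same exponents
    as the polynomial, so that it obeys the same asymptotics. *)
Lemma euler_sum_monomials x j (s : seq (multinom n)) P c :
  x 0 j * peval (mderiv j (\sum_(k <- s | P k) c k *: mpolyX R k)) x =
  \sum_(k <- s | P k) c k * (k j)%:R * peval (mpolyX R k) x.
Proof.
rewrite (raddf_sum (mderiv j)) /peval (raddf_sum (meval (x 0))) mulr_sumr.
apply: eq_bigr => k _ /=.
by rewrite mderivZ mevalZ mulrCA -/(peval _ _) euler_monomial mulrA.
Qed.

End Newton.

(** * Toric limits *)

Lemma seq_argmin (R : realDomainType) (I : eqType) (s : seq I) (c : I -> R) :
  s != [::] -> exists2 i, i \in s & forall j, j \in s -> c i <= c j.
Proof.
elim: s => [//|a [|b s] IH _].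
  by exists a => [|j]; rewrite ?mem_seq1 // => /eqP->.
have [//|i is_ ile] := IH.
have [ai|ia] := leP (c a) (c i).
  exists a; first by rewrite mem_head.
  by move=> j; rewrite in_cons => /predU1P[->//|/ile]; apply: le_trans.
exists i; first by rewrite in_cons is_ orbT.
by move=> j; rewrite in_cons => /predU1P[->|/ile//]; apply: ltW.
Qed.

Lemma near_all_seq (T : Type) (U : set_system T) (I : eqType) (s : seq I)
    (P : I -> T -> Prop) : Filter U ->
  (forall i, i \in s -> \forall t \near U, P i t) ->
  \forall t \near U, forall i, i \in s -> P i t.
Proof.
move=> FU; elim: s => [|a s IH] sP; first exact: nearW.
have Pa := sP a (mem_head _ _).
have {}IH := IH (fun i is_ => sP i (mem_behead (s := a :: s) is_)).
by apply: filterS2 Pa IH => t Pa IH i; rewrite in_cons => /predU1P[->|/IH].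
Qed.

Lemma near_le_seq (T : Type) (R : realDomainType) (U : set_system T)
    (I : eqType) (s : seq I) (c : I -> T -> R) : Filter U ->
  (forall i, i \in s -> exists C, \forall t \near U, c i t <= C) ->
  exists C, \forall t \near U, forall i, i \in s -> c i t <= C.
Proof.
move=> FU; elim: s => [|a s IH] sC; first by exists 0; apply: nearW.
have [C Ca] := sC a (mem_head _ _).
have [D Ds] := IH (fun i is_ => sC i (mem_behead (s := a :: s) is_)).
exists (Num.max C D); apply: filterS2 Ca Ds => t Ca Ds i.
rewrite in_cons le_max => /predU1P[->|/Ds->]; first by rewrite Ca.
by rewrite orbT.
Qed.

Lemma dotvBr (R : realType) (n : nat) (q u v : 'rV[R]_n) :
  dotv q (u - v) = dotv q u - dotv q v.
Proof. by rewrite dotvDr -scaleN1r dotvZr mulN1r. Qed.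

Lemma dotvBl (R : realType) (n : nat) (q u v : 'rV[R]_n) :
  dotv (u - v) q = dotv u q - dotv v q.
Proof. by rewrite -sumrB; apply: eq_bigr => j _; rewrite !mxE mulrBl. Qed.

Lemma ler_norm_dotv (R : realType) (n : nat) (w a : 'rV[R]_n) (C : R) :
  (forall j, `|w 0 j| <= C) -> `|dotv w a| <= C * \sum_j `|a 0 j|.
Proof.
move=> wC; rewrite mulr_sumr; apply: (le_trans (ler_norm_sum _ _ _)).
by apply: ler_sum => j _; rewrite normrM ler_wpM2r.
Qed.

(** A vector can be replaced, without changing its products with the vectors of
    [S], by one whose size is controlled by these products: apply a partial
    inverse of the matrix whose columns are the elements of [S]. *)
Lemma bounded_representative (R : realType) (n : nat) (S : seq 'rV[R]_n) :
  exists (C : R) (W : 'rV[R]_n -> 'rV[R]_n),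
    (forall v a, a \in S -> dotv (W v) a = dotv v a) /\
    (forall v B, (forall a, a \in S -> `|dotv v a| <= B) ->
       forall j, `|W v 0 j| <= B * C).
Proof.
pose A := \matrix_(j < n, l < size S) (nth 0 S l) 0 j.
have AE v l : (v *m A) 0 l = dotv v (nth 0 S l).
  by rewrite mxE; apply: eq_bigr => j _; rewrite mxE.
exists (\sum_l \sum_j `|pinvmx A l j|), (fun v => v *m A *m pinvmx A).
split=> [v a aS|v B vB j].
  have aE : a = nth 0 S (index a S) by rewrite nth_index.
  have ai : (index a S < size S)%N by rewrite index_mem.
  by rewrite [in LHS]aE [in RHS]aE -!(AE _ (Ordinal ai)) mulmxKpV ?submxMl.
rewrite mxE mulr_sumr; apply: (le_trans (ler_norm_sum _ _ _)).
apply: ler_sum => l _; rewrite normrM AE; apply: ler_pM => //.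
  by apply/vB/mem_nth.
by rewrite (bigD1 j) //= lerDl; apply: sumr_ge0.
Qed.

Section ToricLimit.
Variables (R : realType) (n p : nat) (T : Type) (U : set_system T).
Hypothesis UU : UltraFilter U.

(** The weight [q] is the logarithmic vector of [x] up to a bounded term, chosen
    so that monomials of comparable size along [U] get exactly equal weights.
    The polynomials [G i] are then the face polynomials for [q], and
    [expR (dmin q _)] normalizes each [F i] by its dominant monomials. *)
Lemma toric_limit (F : 'I_p -> {mpoly R[n]}) (x : T -> 'rV[R]_n) :
  (forall i, F i != 0) -> (forall t j, x t 0 j != 0) ->
  exists (q : T -> 'rV[R]_n) (y : 'rV[R]_n) (G : 'I_p -> {mpoly R[n]}),
  [/\ forall j, y 0 j != 0,
      exists C, \forall t \near U, forall j, `|q t 0 j + ln `|x t 0 j| | <= C,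
      forall i, \forall t \near U,
        face_poly (F i) (face (q t) (newton (F i))) = G i,
      forall i, peval (F i) (x t) * expR (dmin (q t) (newton (F i)))
        @[t --> U] --> peval (G i) y &
      forall i j, x t 0 j * peval (mderiv j (F i)) (x t) *
        expR (dmin (q t) (newton (F i)))
        @[t --> U] --> y 0 j * peval (mderiv j (G i)) y].
Proof.
move=> F0 x0.
pose v t : 'rV[R]_n := \row_j - ln `|x t 0 j|.
(* [k0 i] is an exponent of a dominant monomial of [F i] along [U]. *)
have /choice[k0 k0P] : forall i, exists k0, k0 \in msupp (F i) /\
    \forall t \near U, forall k, k \in msupp (F i) ->
      dotv (v t) (expvec R k0) <= dotv (v t) (expvec R k).
  move=> i.
  have [|k ks kmin] := @ultra_pick _ _ U (msupp (F i)) (fun k0 t => forall k,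
    k \in msupp (F i) -> dotv (v t) (expvec R k0) <= dotv (v t) (expvec R k)).
    by apply: nearW => t; apply: seq_argmin; rewrite msupp_eq0 F0.
  by exists k.
pose e i k : 'rV[R]_n := expvec R k - expvec R (k0 i).
(* [bd i k]: the monomial [k] is comparable to the dominant monomial of [F i]. *)
pose bd i k := `[< exists C, \forall t \near U, dotv (v t) (e i k) <= C >].
pose S := [seq e ik.1 ik.2 | ik <-
  [seq (i, k) | i <- enum 'I_p, k <- [seq k <- msupp (F i) | bd i k]]].
have SP a : a \in S -> exists i k, [/\ k \in msupp (F i), bd i k & a = e i k].
  move=> /mapP[_ /allpairsPdep[i [k [_ +->]]] ->].
  by rewrite mem_filter => /andP[kb ks]; exists i, k.
have SI i k : k \in msupp (F i) -> bd i k -> e i k \in S.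
  move=> ks kb; apply/mapP; exists (i, k) => //.
  by apply/allpairsPdep; exists i, k; rewrite mem_enum mem_filter ks kb.
have [B vB] : exists B, \forall t \near U,
    forall a, a \in S -> `|dotv (v t) a| <= B.
  apply: near_le_seq => a /SP[i [k [ks /asboolP[C kC] ->]]]; exists C.
  have [_ kmin] := k0P i.
  apply: filterS2 kmin kC => t kmin kC; rewrite ger0_norm //.
  by rewrite dotvBr subr_ge0 kmin.
have [C [W [WS WB]]] := bounded_representative S.
have wBC : \forall t \near U, forall j, `|W (v t) 0 j| <= B * C.
  by apply: filterS vB => t; apply: WB.
(* Subtracting the bounded [W v] makes the comparable monomials tie exactly. *)
pose q t := v t - W (v t).
pose u t j := x t 0 j * expR (q t 0 j).
have un : \forall t \near U, forall j,
    expR (- (B * C)) <= `|u t j| <= expR (B * C).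
  apply: filterS wBC => t wBC j.
  rewrite /u normrM [`|expR _|]ger0_norm ?expR_ge0 //.
  have -> : `|x t 0 j| = expR (- v t 0 j).
    by rewrite mxE opprK lnK ?posrE ?normr_gt0.
  have -> : q t 0 j = v t 0 j - W (v t) 0 j by rewrite !mxE.
  rewrite -expRD addKr !ler_expR.
  by have := wBC j; rewrite ler_norml => /andP[? ?]; rewrite lerNr opprK lerNl; apply/andP.
have /choice[y yP] : forall j, exists l, l != 0 /\ u t j @[t --> U] --> l.
  move=> j.
  have [|l _ ul] := @ultra_bounded_cvg _ R U (u^~ j) (- expR (B * C))
    (expR (B * C)) UU.
    by apply: filterS un => t /(_ j)/andP[_]; rewrite ler_norml.
  exists l; split => //; rewrite -normr_gt0.
  apply: (lt_le_trans (expR_gt0 (- (B * C)))).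
  apply: (@cvgr_to_ge _ U _ _ (fun t => `|u t j|)); first exact: cvg_norm.
  by apply: filterS un => t /(_ j)/andP[].
pose Y : 'rV[R]_n := \row_j y j.
(* The exponents that tie stay tied for [q]; the others still lag infinitely,
   because [W v] is bounded. *)
have dich i k : k \in msupp (F i) ->
    if bd i k then \forall t \near U, dotv (q t) (e i k) = 0
    else dotv (q t) (e i k) @[t --> U] --> +oo.
  move=> ks; case: ifPn => [kb|/asboolPn kb].
    by apply: nearW => t; rewrite dotvBl WS ?subrr //; apply: SI.
  apply/cvgryPge => A.
  pose D := B * C * \sum_j `|(e i k) 0 j|.
  have kA : \forall t \near U, ~ (dotv (v t) (e i k) <= A + D).
    by apply: ultra_not => ?; apply: kb; exists (A + D).
  apply: filterS2 wBC kA => t wBC /negP; rewrite -ltNge => kA.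
  rewrite dotvBl lerBrDr (le_trans _ (ltW kA)) // lerD2l.
  by apply: (le_trans (ler_norm _)); apply: ler_norm_dotv.
have qmin i : \forall t \near U, forall k, k \in msupp (F i) ->
    if bd i k then dotv (q t) (expvec R k) = dotv (q t) (expvec R (k0 i))
    else dotv (q t) (expvec R k) > dotv (q t) (expvec R (k0 i)).
  apply: near_all_seq => k ks; have := dich i k ks.
  case: ifP => _ => [|/cvgryPgt/(_ 0)]; apply: filterS => t.
    by rewrite dotvBr => /eqP; rewrite subr_eq0 => /eqP.
  by rewrite dotvBr subr_gt0.
have dE i : \forall t \near U,
    dmin (q t) (newton (F i)) = dotv (q t) (expvec R (k0 i)).
  apply: filterS (qmin i) => t kq; apply: dmin_newton; first by case: (k0P i).
  by move=> k /kq; case: ifP => _ => [->//|/ltW].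
have sum_cvg i (b : multinom n -> R) :
  (\sum_(k <- msupp (F i)) b k * peval (mpolyX R k) (x t)) *
    expR (dmin (q t) (newton (F i))) @[t --> U] -->
  \sum_(k <- msupp (F i) | bd i k) b k * peval (mpolyX R k) Y.
  have monoE t k : peval (mpolyX R k) (x t) =
      peval (mpolyX R k) (\row_j u t j) * expR (- dotv (q t) (expvec R k)).
    rewrite /peval !mevalX -sumrN expR_sum -big_split; apply: eq_bigr => j _ /=.
    have -> : expvec R k 0 j = (k j)%:R by rewrite mxE.
    have -> : (\row_l u t l) 0 j = u t j by rewrite mxE.
    by rewrite /u exprMn -expRM_natr -mulrA -expRD subrr expR0 mulr1.
  rewrite [X in _ --> X]big_mkcond /=.
  under eq_fun do rewrite mulr_suml.
  apply: cvgr_sum_seq => k ks.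
  have uY : peval (mpolyX R k) (\row_j u t j) @[t --> U] --> peval (mpolyX R k) Y.
    apply: peval_cvg => j; rewrite mxE; under eq_fun do rewrite mxE.
    by case: (yP j).
  apply: cvg_trans (_ : (b k * peval (mpolyX R k) (\row_j u t j)) *
    expR (- dotv (q t) (e i k)) @[t --> U] `=>` _).
    apply: near_eq_cvg; apply: filterS (dE i) => t ->.
    by rewrite monoE dotvBr -!mulrA -expRD opprB addrC.
  have := dich i k ks; case: ifP => _ qe.
    apply: cvg_trans (_ : b k * peval (mpolyX R k) (\row_j u t j)
      @[t --> U] `=>` _).
      by apply: near_eq_cvg; apply: filterS qe => t ->; rewrite oppr0 expR0 mulr1.
    by apply: cvgM => //; apply: cvg_cst.
  have -> : nbhs (0 : R) = nbhs (b k * peval (mpolyX R k) Y * 0) by rewrite mulr0.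
  apply: cvgM; first by apply: cvgM => //; apply: cvg_cst.
  exact: cvg_comp qe (@cvgr_expR R).
exists q, Y, (fun i => \sum_(k <- msupp (F i) | bd i k) mcoeff k (F i) *: mpolyX R k).
split.
- by move=> j; rewrite mxE; case: (yP j).
- exists (B * C); apply: filterS wBC => t wBC j.
  by rewrite /q !mxE addrAC addNr add0r normrN.
- move=> i; apply: filterS2 (dE i) (qmin i) => t dEt qt.
  rewrite /face_poly; rewrite big_seq_cond [RHS]big_seq_cond.
  apply: eq_bigl => k; case ks : (k \in msupp (F i)) => //=.
  have {}ks : k \in msupp (F i) by rewrite ks.
  have := qt k ks; rewrite /face dEt /=; case: ifP => _ qk.
    by apply/asboolP; split => //; apply: msupp_newton.
  by apply/asboolP => -[_ qk']; move: qk; rewrite qk' ltxx.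
- move=> i; rewrite peval_sum_monomials.
  have {1}-> : F i = \sum_(k <- msupp (F i)) mcoeff k (F i) *: mpolyX R k.
    exact: mpolyE.
  by under eq_fun do rewrite peval_sum_monomials; apply: sum_cvg.
- move=> i j; rewrite euler_sum_monomials.
  have {1}-> : F i = \sum_(k <- msupp (F i)) mcoeff k (F i) *: mpolyX R k.
    exact: mpolyE.
  by under eq_fun do rewrite euler_sum_monomials; apply: sum_cvg.
Qed.
End ToricLimit.
(** * Non-degeneracy forbids multipliers at infinity *)

Lemma ltn_enum_val (p : nat) (J : {set 'I_p}) (a b : 'I_#|J|) :
  (a < b)%N -> (enum_val a < enum_val b)%N.
Proof.
move=> ab; pose x0 := enum_val a.
rewrite !(enum_val_nth x0).
have s : sorted (fun i j : 'I_p => (i < j)%N) (enum J).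
  rewrite {1}/enum_mem; apply: sorted_filter.
    by move=> ? ? ?; apply: ltn_trans.
  have := iota_ltn_sorted 0 p; rewrite -val_enum_ord sorted_map.
  by rewrite enumT.
apply: (sorted_ltn_nth (leT := fun i j : 'I_p => (i < j)%N)) => //.
- by move=> ? ? ?; apply: ltn_trans.
- by rewrite inE -cardE.
- by rewrite inE -cardE.
Qed.

Lemma bounded_cvg0M (T : Type) (R : realType) (U : set_system T)
    (c u : T -> R) (B : R) : Filter U ->
  (\forall t \near U, `|c t| <= B) -> u t @[t --> U] --> 0 ->
  (c t * u t) @[t --> U] --> 0.
Proof.
move=> FU cB u0; apply/norm_cvg0P.
apply: (@squeeze_cvgr _ U _ R (fun=> 0) (fun t => B * `|u t|)).
- apply: filterS cB => t cB; rewrite normr_ge0 normrM /=.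
  exact: ler_wpM2r.
- exact: cvg_cst.
- have -> : nbhs (0 : R) = nbhs (B * `|0 : R|) by rewrite normr0 mulr0.
  by apply: cvgM; [apply: cvg_cst|apply: cvg_norm].
Qed.

Section Obstruction.
Variables (R : realType) (n p : nat) (F : 'I_p -> {mpoly R[n]}) (i0 : 'I_p).
Hypotheses (Fconv : convenient F) (Fnd : nondegenerate_at_infinity F).

(** Weighted by [expR (- d i)], which tends to infinity by convenience, the
    bounded products vanish in the limit. The indices whose weight is comparable
    to the largest one form the tuple to which non-degeneracy is applied. *)
Lemma toric_obstruction (T : Type) (U : set_system T) (x : T -> 'rV[R]_n)
    (lam : T -> 'I_p -> R) (B : R) (j : 'I_n) : UltraFilter U ->
  (forall t l, x t 0 l != 0) -> (forall t i, 0 <= lam t i) ->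
  (forall t, lam t i0 = 1) ->
  (forall t i, `|lam t i * peval (F i) (x t)| <= B) ->
  (forall t l, `|x t 0 l * \sum_i lam t i * peval (mderiv l (F i)) (x t)| <= B) ->
  ~ `|x t 0 j| @[t --> U] --> +oo.
Proof.
move=> UU x0 lam0 lam1 lamF lamG xj.
have F0 i : F i != 0.
  have [k ks _] := convenient_axis j (Fconv i).
  by rewrite -msupp_eq0; apply: contraTneq ks => ->.
have [q [y [G [y0 [C qC] fG Fy Gy]]]] := toric_limit UU F0 x0.
pose d i t := dmin (q t) (newton (F i)).
have dinf i : - d i t @[t --> U] --> +oo.
  have [k ks [kj kl]] := convenient_axis j (Fconv i).
  apply/cvgryPge => A.
  have /cvgryPge/(_ (expR (C + Num.max A 0))) xA := xj.
  apply: filterS2 qC xA => t /(_ j) {}qC {}xA.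
  have lx : C + Num.max A 0 <= ln `|x t 0 j|.
    by rewrite -ler_expR lnK ?posrE ?normr_gt0.
  have qA : q t 0 j <= - Num.max A 0.
    by move: qC; rewrite ler_norml => /andP[_]; lra.
  rewrite lerNr.
  have [_ _ [_ /(_ _ (msupp_newton ks)) dk]] := newton_min (q t) (F0 i).
  apply: (le_trans dk).
  rewrite /dotv (bigD1 j) //= big1 ?addr0; last first.
    by move=> l /kl kl0; rewrite mxE kl0 mulr0.
  have mA : A <= Num.max A 0 by rewrite le_max lexx.
  have m0 : 0 <= Num.max A 0 by rewrite le_max lexx orbT.
  have k1 : 1 <= (k j)%:R :> R by rewrite ler1n.
  rewrite mxE; apply: (@le_trans _ _ (q t 0 j)); last by lra.
  by rewrite -[leRHS]mulr1 ler_wnM2l //; lra.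
pose mu i t := lam t i * expR (- d i t).
have mu_ge0 i t : 0 <= mu i t by rewrite mulr_ge0 ?expR_ge0.
(* [i1] is an index of largest weight along [U]. *)
have [i1 _ i1max] : exists2 i1, i1 \in enum 'I_p &
    \forall t \near U, forall i, mu i t <= mu i1 t.
  apply: (@ultra_pick _ _ U _ (fun i1 t => forall i, mu i t <= mu i1 t)).
  apply: nearW => t.
  have [|i1 i1e i1m] := @seq_argmin R _ (enum 'I_p) (fun i => - mu i t).
    by apply/negP => /eqP e; have := mem_enum 'I_p i0; rewrite e.
  exists i1 => // i; rewrite -lerN2; apply: i1m; exact: mem_enum.
have mu_inf : mu i1 t @[t --> U] --> +oo.
  apply/cvgryPge => A; have /cvgryPge/(_ A) := dinf i0.
  apply: filterS2 i1max => t /(_ i0) le1 le2; apply: le_trans le1.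
  rewrite /mu lam1 mul1r; apply: (le_trans le2).
  by apply: le_trans (expR_ge1Dx _); rewrite lerDr.
have mu_gt0 : \forall t \near U, 0 < mu i1 t by have /cvgryPgt/(_ 0) := mu_inf.
have mu_inv : (mu i1 t)^-1 @[t --> U] --> 0 by apply/gtr0_cvgV0.
pose r i t := mu i t / mu i1 t.
have /choice[rho rhoP] : forall i, exists l : R, r i t @[t --> U] --> l.
  move=> i; have [|l _ rl] := @ultra_bounded_cvg _ R U (r i) 0 1 UU; last by exists l.
  apply: filterS2 mu_gt0 i1max => t m0 mi.
  by rewrite divr_ge0 //= ler_pdivrMr // mul1r.
have rho1 : rho i1 = 1.
  have e1 : \forall t \near U, r i1 t = 1.
    by apply: filterS mu_gt0 => t m0; rewrite /r divff ?gt_eqF.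
  apply/eqP; rewrite eq_le; apply/andP; split.
    by apply: (cvgr_to_le (rhoP i1)); apply: filterS e1 => t ->.
  by apply: (cvgr_to_ge (rhoP i1)); apply: filterS e1 => t ->.
(* The normalization of [F i] cancels against its weight. *)
have rE i t z : r i t * (z * expR (d i t)) = lam t i * z * (mu i1 t)^-1.
  have ee : expR (- d i t) * expR (d i t) = 1 by rewrite -expRD addNr expR0.
  by rewrite /r {1}/mu -[RHS]mulr1 -ee; ring.
have Gy0 i : rho i != 0 -> peval (G i) y = 0.
  move=> ri; apply: (mulfI ri); rewrite mulr0.
  apply: (@cvg_unique _ (@Rhausdorff R) (r i t * (peval (F i) (x t) * expR (d i t)) @[t --> U])).
    exact: cvgM.
  rewrite /=; under eq_fun do rewrite rE.
  by apply: bounded_cvg0M mu_inv; apply: nearW => t; apply: lamF.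
have DGy0 l : \sum_i rho i * peval (mderiv l (G i)) y = 0.
  apply: (mulfI (y0 l)); rewrite mulr0 mulr_sumr.
  under eq_bigr do rewrite mulrCA.
  apply: (@cvg_unique _ (@Rhausdorff R) (\sum_i r i t *
      (x t 0 l * peval (mderiv l (F i)) (x t) * expR (d i t)) @[t --> U])).
    by apply: cvgr_sum_seq => i _; apply: cvgM.
  rewrite /=; under eq_fun do under eq_bigr do rewrite rE mulrCA.
  under eq_fun do rewrite -mulr_suml -mulr_sumr.
  by apply: bounded_cvg0M mu_inv; apply: nearW => t; apply: lamG.
pose J := [set i | rho i != 0]%SET.
have i1J : i1 \in J by rewrite inE rho1 oner_neq0.
(* A single [t] far enough along [U] provides the weight vector [q t]. *)
have [t [tG td]] : exists t, (forall i,
    face_poly (F i) (face (q t) (newton (F i))) = G i) /\ forall i, d i t < 0.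
  apply: (@filter_ex _ U); apply: filterI; apply: filter_forall => i //.
  by have /cvgryPgt/(_ 0) := dinf i; apply: filterS => t; rewrite oppr_gt0.
apply: (Fnd (s := fun a : 'I_#|J| => enum_val a) _ (@ltn_enum_val p J)) (q t) _ _.
- by apply/card_gt0P; exists i1.
- by move=> a; apply: td.
exists y, (\row_a rho (enum_val a)); split=> //.
- by move=> a; rewrite mxE; have := enum_valP a; rewrite inE.
- by move=> a; rewrite tG; apply: Gy0; have := enum_valP a; rewrite inE.
apply/rowP => l; rewrite mxE summxE -[RHS](DGy0 l).
rewrite (bigID (mem J)) /= [X in _ = _ + X]big1 ?addr0; last first.
  by move=> i; rewrite inE negbK => /eqP->; rewrite mul0r.
rewrite [RHS]big_enum_val; apply: eq_bigr => a _.
by rewrite !mxE tG.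
Qed.

End Obstruction.
Section BoundedMultipliers.
Variables (R : realType) (n p : nat) (F : 'I_p -> {mpoly R[n]}) (i0 : 'I_p).
Hypotheses (Fconv : convenient F) (Fnd : nondegenerate_at_infinity F).

(** Strict bounds are open conditions, hence the vanishing coordinates may be
    moved away from zero; this removes the need to work in coordinate
    subspaces. *)
Lemma perturb_nonzero_coordinates (x : 'rV[R]_n) (lam : 'I_p -> R) (j : 'I_n)
    (B k : R) : k < `|x 0 j| ->
  (forall i, `|lam i * peval (F i) x| < B) ->
  (forall l, `|x 0 l * \sum_i lam i * peval (mderiv l (F i)) x| < B) ->
  exists x' : 'rV[R]_n, [/\ forall l, x' 0 l != 0, k < `|x' 0 j|,
    forall i, `|lam i * peval (F i) x'| < B &
    forall l, `|x' 0 l * \sum_i lam i * peval (mderiv l (F i)) x'| < B].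
Proof.
move=> kx xF xG.
pose z s : 'rV[R]_n := \row_l (x 0 l + s * (x 0 l == 0)%:R).
have zx l : z s 0 l @[s --> 0^'+] --> x 0 l.
  under eq_fun do rewrite mxE.
  have -> : nbhs (x 0 l) = nbhs (x 0 l + 0 * (x 0 l == 0)%:R).
    by rewrite mul0r addr0.
  apply: cvgD; first exact: cvg_cst.
  apply: cvgM; last exact: cvg_cst.
  by apply: cvg_at_right_filter; apply: cvg_id.
have [s [[z0 zj] [zF zG]]] : exists s, ((forall l, z s 0 l != 0) /\
    k < `|z s 0 j|) /\ ((forall i, `|lam i * peval (F i) (z s)| < B) /\
    forall l, `|z s 0 l * \sum_i lam i * peval (mderiv l (F i)) (z s)| < B);
    last by exists (z s).
apply: (@filter_ex _ (0^'+ : set_system R)).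
have pcvg h : peval h (z s) @[s --> 0^'+] --> peval h x by apply: peval_cvg.
apply: filterI; apply: filterI.
- have : \forall s \near 0^'+, (0 : R) < s by exact: nbhs_right_gt.
  apply: filterS => s s0 l; rewrite mxE.
  have [->|xl] := eqVneq (x 0 l) 0; first by rewrite add0r mulr1 gt_eqF.
  by rewrite mulr0 addr0.
- by apply: (cvgr_gt _ (cvg_norm (zx j)) _ kx).
- apply: (@filter_forall _ _ (fun i s => `|lam i * peval (F i) (z s)| < B) 0^'+ _).
  move=> i.
  have zF : lam i * peval (F i) (z s) @[s --> 0^'+] --> lam i * peval (F i) x.
    by apply: cvgM; [apply: cvg_cst|].
  by apply: (cvgr_lt _ (cvg_norm zF) _ (xF i)).
- apply: (@filter_forall _ _ (fun l s =>
    `|z s 0 l * \sum_i lam i * peval (mderiv l (F i)) (z s)| < B) 0^'+ _) => l.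
  have zG : z s 0 l * \sum_i lam i * peval (mderiv l (F i)) (z s) @[s --> 0^'+]
      --> x 0 l * \sum_i lam i * peval (mderiv l (F i)) x.
    apply: cvgM => //.
    by apply: cvgr_sum_seq => i _; apply: cvgM; [apply: cvg_cst|].
  by apply: (cvgr_lt _ (cvg_norm zG) _ (xG l)).
Qed.

Lemma bounded_multipliers_bounded_points (B : R) : exists r : R,
  forall (x : 'rV[R]_n) (lam : 'I_p -> R), (forall i, 0 <= lam i) ->
  lam i0 = 1 -> (forall i, `|lam i * peval (F i) x| <= B) ->
  (forall l, `|x 0 l * \sum_i lam i * peval (mderiv l (F i)) x| <= B) ->
  forall j, `|x 0 j| <= r.
Proof.
apply: contrapT => nr.
have /choice[w wP] : forall k : nat, exists w : 'rV[R]_n * ('I_p -> R),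
    ((forall l, w.1 0 l != 0) /\ exists j, k%:R < `|w.1 0 j|) /\
    [/\ forall i, 0 <= w.2 i, w.2 i0 = 1,
        forall i, `|w.2 i * peval (F i) w.1| <= B + 1 &
        forall l, `|w.1 0 l * \sum_i w.2 i * peval (mderiv l (F i)) w.1|
          <= B + 1].
  move=> k; apply: contrapT => nk; apply: nr; exists k%:R.
  move=> x lam lam0 lam1 lamF lamG j; rewrite leNgt; apply/negP => kx.
  have [||x' [x0' xk' xF xG]] := @perturb_nonzero_coordinates x lam j (B + 1) _ kx.
  - by move=> i; apply: le_lt_trans (lamF i) _; rewrite ltrDl.
  - by move=> l; apply: le_lt_trans (lamG l) _; rewrite ltrDl.
  apply: nk; exists (x', lam); split; first by split=> //; exists j.
  by split=> // i; apply: ltW.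
have [U [UU oU]] := ultraFilterLemma (eventually_filter : ProperFilter \oo).
have [j _ jU] : exists2 j, j \in enum 'I_n & \forall k \near U, k%:R < `|(w k).1 0 j|.
  apply: (@ultra_pick _ _ U _ (fun j k => k%:R < `|(w k).1 0 j|)).
  apply: nearW => k; have [[_ [j jk]] _] := wP k.
  by exists j; rewrite ?mem_enum.
have wj : `|(w k).1 0 j| @[k --> U] --> +oo.
  apply/cvgryPge => A.
  have : \forall k \near U, A <= k%:R.
    by apply: oU; have /cvgryPge := @cvgr_idn R; apply.
  by apply: filterS2 jU => k /ltW kj Ak; apply: le_trans kj.
apply: (toric_obstruction Fconv Fnd (i0 := i0) (B := B + 1)
  (x := fun k => (w k).1) (lam := fun k => (w k).2)) wj.
all: by move=> k; have [[? ?] [? ? ? ?]] := wP k.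
Qed.

End BoundedMultipliers.

(** * Smoothing of the positive part *)

Section SmoothPos.
Variable R : realType.
Implicit Types d t e : R.

Definition hypot d t : R := Num.sqrt (t ^+ 2 + d ^+ 2).

(** A smooth convex majorant of the positive part, which it exceeds by at most
    [d]. *)
Definition smooth_pos d t : R := (t + hypot d t) / 2.

(** The derivative of [smooth_pos d] at [t]. *)
Definition smooth_slope d t : R := (1 + t / hypot d t) / 2.

Lemma hypot_gt0 d t : 0 < d -> 0 < hypot d t.
Proof. by move=> d0; rewrite sqrtr_gt0 ltr_wpDl ?sqr_ge0 ?exprn_gt0. Qed.

Lemma sqr_hypot d t : hypot d t ^+ 2 = t ^+ 2 + d ^+ 2.
Proof. by rewrite sqr_sqrtr // addr_ge0 ?sqr_ge0. Qed.

Lemma ler_norm_hypot d t : `|t| <= hypot d t.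
Proof. by rewrite -sqrtr_sqr ler_wsqrtr // lerDl sqr_ge0. Qed.

Lemma hypot_le d t : 0 < d -> hypot d t <= `|t| + d.
Proof.
move=> d0; have h0 : 0 <= `|t| + d by rewrite addr_ge0 // ltW.
rewrite -[leRHS]ger0_norm // -sqrtr_sqr ler_wsqrtr //.
rewrite -[t ^+ 2]real_normK ?num_real // sqrrD mulr2n.
by have : 0 <= `|t| * d; [rewrite mulr_ge0 // ltW|lra].
Qed.

Lemma smooth_pos_ge d t : Num.max t 0 <= smooth_pos d t.
Proof.
have := ler_norm_hypot d t; rewrite ler_norml /smooth_pos => /andP[? ?].
by rewrite ge_max; apply/andP; split; lra.
Qed.

Lemma smooth_pos_le d t : 0 < d -> smooth_pos d t <= Num.max t 0 + d.
Proof.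
move=> d0; have := hypot_le t d0; rewrite /smooth_pos.
case: (leP t 0) => [t0|t0]; first by rewrite ler0_norm //; lra.
by rewrite gtr0_norm //; lra.
Qed.

Lemma smooth_slope_ge0 d t : 0 < d -> 0 <= smooth_slope d t.
Proof.
move=> d0; have h0 := hypot_gt0 t d0.
have := ler_norm_hypot d t; rewrite ler_norml => /andP[t1 t2].
rewrite divr_ge0 // -(@divff _ (hypot d t)) ?gt_eqF // -mulrDl.
by rewrite divr_ge0 ?(ltW h0) //; lra.
Qed.

Lemma smooth_slope_le1 d t : 0 < d -> smooth_slope d t <= 1.
Proof.
move=> d0; have h0 := hypot_gt0 t d0.
have := ler_norm_hypot d t; rewrite ler_norml => /andP[t1 t2].
have : t / hypot d t <= 1 by rewrite ler_pdivrMr // mul1r.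
by rewrite /smooth_slope; lra.
Qed.

Lemma smooth_slope_ge_half d t : 0 < d -> 0 <= t -> 1 / 2 <= smooth_slope d t.
Proof.
move=> d0 t0; have h0 := hypot_gt0 t d0.
have : 0 <= t / hypot d t by rewrite divr_ge0 // ltW.
by rewrite /smooth_slope; lra.
Qed.

(** Approximate complementarity: where the constraint value [t] is very
    negative, the slope is small enough to compensate. *)
Lemma ler_norm_smooth_slopeM d t : 0 < d ->
  `|smooth_slope d t * t| <= Num.max t 0 + d.
Proof.
move=> d0; have s0 := smooth_slope_ge0 t d0; have s1 := smooth_slope_le1 t d0.
have h0 := hypot_gt0 t d0.
case: (leP t 0) => [t0|t0].
  rewrite normrM (ger0_norm s0) (ler0_norm t0) add0r.
  (* For negative [t] the slope is at most [(hypot - |t|) / (2 hypot)]. *)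
  have -> : smooth_slope d t * - t = (- t / hypot d t) * ((hypot d t + t) / 2).
    by rewrite /smooth_slope; field; rewrite gt_eqF.
  have t1 : - t / hypot d t <= 1.
    rewrite ler_pdivrMr // mul1r; have := ler_norm_hypot d t.
    by rewrite ler0_norm.
  have t2 : 0 <= - t / hypot d t by rewrite divr_ge0 ?oppr_ge0 // ltW.
  have := hypot_le t d0; have := ler_norm_hypot d t; rewrite ler0_norm // => ? ?.
  by rewrite -[leRHS]mul1r; apply: ler_pM => //; lra.
rewrite ger0_norm; last exact: mulr_ge0 s0 (ltW t0).
by apply: (@le_trans _ _ t); [rewrite ger_pMl|rewrite lerDl ltW].
Qed.

(** Arithmetic-geometric mean inequality: the hypotenuse lies below a parabola
    tangent to it at [t]. *)
Lemma smooth_pos_parabola d t e : 0 < d ->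
  smooth_pos d (t + e) <=
  smooth_pos d t + smooth_slope d t * e + e ^+ 2 / (4 * hypot d t).
Proof.
move=> d0; have h0 := hypot_gt0 t d0; have h1 := hypot_gt0 (t + e) d0.
have h2 := sqr_hypot d t; have h3 := sqr_hypot d (t + e).
have hp : hypot d (t + e) <= hypot d t + t * e / hypot d t + e ^+ 2 / (2 * hypot d t).
  rewrite -subr_ge0.
  have -> : hypot d t + t * e / hypot d t + e ^+ 2 / (2 * hypot d t) -
      hypot d (t + e) = (hypot d t - hypot d (t + e)) ^+ 2 / (2 * hypot d t).
    rewrite sqrrB h3 sqrrD.
    have -> : d ^+ 2 = hypot d t ^+ 2 - t ^+ 2 by rewrite h2 addrC addKr.
    by field; rewrite gt_eqF.
  by rewrite divr_ge0 ?sqr_ge0 // mulr_ge0 // ltW.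
rewrite /smooth_pos /smooth_slope.
have -> : (1 + t / hypot d t) / 2 * e = e / 2 + (t * e / hypot d t) / 2.
  by field; rewrite gt_eqF.
have -> : e ^+ 2 / (4 * hypot d t) = (e ^+ 2 / (2 * hypot d t)) / 2.
  by field; rewrite gt_eqF.
lra.
Qed.

(** With [d = 0] the smoothing is exact, so that continuity of the positive part
    is an instance of [smooth_pos_cvg]. *)
Lemma smooth_pos0 t : smooth_pos 0 t = Num.max t 0.
Proof. by rewrite /smooth_pos /hypot expr0n addr0 sqrtr_sqr maxr_absE addr0 subr0. Qed.

Lemma smooth_pos_cvg (T : Type) (U : set_system T) d (u : T -> R) (l : R) :
  Filter U -> u t @[t --> U] --> l ->
  smooth_pos d (u t) @[t --> U] --> smooth_pos d l.
Proof.
move=> FU ul; rewrite /smooth_pos /hypot.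
apply: cvgM; last exact: cvg_cst.
apply: cvgD => //.
have ul2 : (u t ^+ 2 + d ^+ 2) @[t --> U] --> l ^+ 2 + d ^+ 2.
  by apply: cvgD; [apply: cvgrX|apply: cvg_cst].
exact: continuous_cvg (@sqrt_continuous R _) ul2.
Qed.

End SmoothPos.

(** * Second-order upper models along a coordinate line *)

Section UpperModel.
Variable R : realType.

(** An upper bound suffices to read off stationarity at a minimum, so that the
    smoothed penalty never has to be differentiated. *)
Definition upper_model (phi : R -> R) (D : R) : Prop :=
  exists K, forall s, `|s| <= 1 -> phi s <= phi 0 + s * D + K * s ^+ 2.

Lemma upper_modelD phi1 phi2 D1 D2 : upper_model phi1 D1 ->
  upper_model phi2 D2 -> upper_model (fun s => phi1 s + phi2 s) (D1 + D2).
Proof.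
move=> [K1 h1] [K2 h2]; exists (K1 + K2) => s s1.
by have := lerD (h1 s s1) (h2 s s1); lra.
Qed.

Lemma upper_modelZ c phi D : 0 <= c -> upper_model phi D ->
  upper_model (fun s => c * phi s) (c * D).
Proof.
move=> c0 [K h]; exists (c * K) => s s1.
by have := ler_wpM2l c0 (h s s1); rewrite !mulrDr !mulrA [s * c]mulrC.
Qed.

Lemma upper_model_sum (m : nat) (phi : 'I_m -> R -> R) (D : 'I_m -> R) :
  (forall i, upper_model (phi i) (D i)) ->
  upper_model (fun s => \sum_i phi i s) (\sum_i D i).
Proof.
move=> h.
suff : forall r : seq 'I_m, upper_model (fun s => \sum_(i <- r) phi i s)
  (\sum_(i <- r) D i) by apply.
elim=> [|i r IH].
  by exists 0 => s _; rewrite !big_nil; lra.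
have [K hK] := upper_modelD (h i) IH.
by exists K => s s1; rewrite !big_cons; apply: hK.
Qed.

Lemma upper_model_stationary phi D : upper_model phi D ->
  (forall s, phi 0 <= phi s) -> D = 0.
Proof.
move=> [K hK] hmin.
(* [M] exceeds [K], and the step [- D / M] stays in the unit interval. *)
pose M := `|K| + `|D| + 1.
have M0 : 0 < M by rewrite ltr_wpDl // addr_ge0.
have KM : K < M by rewrite /M; have := ler_norm K; have := normr_ge0 D; lra.
have DM : `|- D / M| <= 1.
  rewrite normrM normrN normfV (gtr0_norm M0) ler_pdivrMr // mul1r /M.
  by have := normr_ge0 K; lra.
have := le_trans (hmin _) (hK _ DM).
rewrite -addrA lerDl => h; apply/eqP; rewrite -sqrf_eq0; apply/eqP.
have e : - D / M * D + K * (- D / M) ^+ 2 = D ^+ 2 * ((K - M) / M ^+ 2).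
  by field; rewrite gt_eqF.
apply/eqP; rewrite eq_le sqr_ge0 andbT.
rewrite e in h; rewrite leNgt; apply/negP => D0.
rewrite pmulr_rge0 // in h; move: h; apply/negP; rewrite -ltNge.
by rewrite pmulr_llt0 ?invr_gt0 ?exprn_gt0 // subr_lt0.
Qed.

End UpperModel.

Section Taylor.
Variables (R : realType) (n : nat) (x : 'rV[R]_n) (j : 'I_n).
Implicit Types h : {mpoly R[n]}.

Let line (s : R) : 'rV[R]_n := x + s *: delta_mx 0 j.

Definition second_order h : Prop := exists2 K, 0 <= K & forall s, `|s| <= 1 ->
  `|peval h (line s) - peval h x - s * peval (mderiv j h) x| <= K * s ^+ 2.

Lemma second_order_add h1 h2 :
  second_order h1 -> second_order h2 -> second_order (h1 + h2).
Proof.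
move=> [K1 K10 H1] [K2 K20 H2]; exists (K1 + K2); first exact: addr_ge0.
move=> s s1; rewrite mderivD /peval !mevalD mulrDl.
apply: le_trans (lerD (H1 s s1) (H2 s s1)); apply: le_trans (ler_normD _ _).
by rewrite le_eqVlt; apply/orP; left; apply/eqP; congr (`|_|); rewrite /peval; ring.
Qed.

Lemma second_order_scale c h : second_order h -> second_order (c *: h).
Proof.
move=> [K K0 H]; exists (`|c| * K); first exact: mulr_ge0.
move=> s s1; rewrite mderivZ /peval !mevalZ -mulrA.
apply: le_trans (ler_wpM2l (normr_ge0 c) (H s s1)); rewrite -normrM.
by rewrite le_eqVlt; apply/orP; left; apply/eqP; congr (`|_|); rewrite /peval; ring.
Qed.

(** The remainder of a product is controlled by those of the factors, since
    [|s| <= 1] bounds the first-order terms. *)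
Lemma second_order_mul h1 h2 :
  second_order h1 -> second_order h2 -> second_order (h1 * h2).
Proof.
move=> [K1 K10 H1] [K2 K20 H2]; rewrite /second_order mderivM.
rewrite /peval; move: H1 H2; rewrite /peval.
set a1 := meval (x 0) h1; set a2 := meval (x 0) h2.
set b1 := meval (x 0) (mderiv j h1); set b2 := meval (x 0) (mderiv j h2).
move=> H1 H2.
exists (`|b1 * b2| + K1 * (`|a2| + `|b2| + K2) + (`|a1| + `|b1|) * K2).
  by rewrite !addr_ge0 ?mulr_ge0 ?addr_ge0.
move=> s s1; have := H1 s s1; have := H2 s s1.
rewrite mevalD !mevalM -/a1 -/a2 -/b1 -/b2.
set e1 := (X in `|X| <= K1 * _); set e2 := (X in `|X| <= K2 * _) => e2K e1K.
have -> : meval (line s 0) h1 = a1 + s * b1 + e1 by rewrite /e1; ring.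
have -> : meval (line s 0) h2 = a2 + s * b2 + e2 by rewrite /e2; ring.
have -> : (a1 + s * b1 + e1) * (a2 + s * b2 + e2) - a1 * a2 -
    s * (b1 * a2 + a1 * b2) =
  b1 * b2 * s ^+ 2 + e1 * (a2 + s * b2 + e2) + (a1 + s * b1) * e2 by ring.
have s2 : s ^+ 2 <= 1 by rewrite -[s ^+ 2]real_normK ?num_real // exprn_ile1.
have sb b : `|s * b| <= `|b| by rewrite normrM ler_piMl.
apply: (le_trans (ler_normD _ _)); rewrite [leRHS]mulrDl; apply: lerD.
  apply: (le_trans (ler_normD _ _)); rewrite [leRHS]mulrDl; apply: lerD.
    by rewrite normrM [`|s ^+ 2|]ger0_norm ?sqr_ge0.
  rewrite normrM -mulrA [_ * s ^+ 2]mulrC mulrA; apply: ler_pM => //.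
  apply: (le_trans (ler_normD _ _)); apply: lerD.
    by apply: (le_trans (ler_normD _ _)); rewrite lerD.
  by apply: (le_trans e2K); rewrite ler_piMr.
rewrite normrM -mulrA; apply: ler_pM => //.
by apply: (le_trans (ler_normD _ _)); rewrite lerD.
Qed.

Lemma second_order_const c : second_order (mpolyC n c).
Proof.
exists 0 => // s _.
by rewrite mderivC /peval !mevalC mulr0 subrr subr0 normr0 mul0r.
Qed.

Lemma second_order_var i : second_order (mpolyX R (mnm1 i)).
Proof.
exists 0 => // s _; rewrite /peval mderivX mevalZ !mevalXU mnm1E !mxE mul0r.
rewrite eqxx /=; have [->|ij] := eqVneq i j.
  rewrite mevalX big1 ?mulr1 ?normr_le0; last first.
    by move=> l _; rewrite mnmBE subnn expr0.
  by apply/eqP; ring.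
by rewrite !mul0r mulr0 addr0 !subrr normr0.
Qed.

Lemma peval_second_order h : second_order h.
Proof.
have one : second_order 1 := second_order_const 1.
elim/mpolyind: h => [|c m h _ _ IH].
  by rewrite -(mpolyC0 n R); apply: second_order_const.
apply: second_order_add => //; apply: second_order_scale.
rewrite mpolyXE_id; apply: big_ind => //; first exact: second_order_mul.
move=> i _; elim: (m i) => [|k IHk]; first by rewrite expr0.
by rewrite exprS; apply: second_order_mul => //; apply: second_order_var.
Qed.

Lemma peval_upper_model h :
  upper_model (fun s => peval h (line s)) (peval (mderiv j h) x).
Proof.
have [K K0 hK] := peval_second_order h; exists K => s /hK.
have -> : line 0 = x by rewrite /line scale0r addr0.
by rewrite ler_norml => /andP[_]; lra.
Qed.

Lemma smooth_pos_upper_model d h : 0 < d ->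
  upper_model (fun s => smooth_pos d (peval h (line s)))
    (smooth_slope d (peval h x) * peval (mderiv j h) x).
Proof.
move=> d0; have [K K0 hK] := peval_second_order h.
have -> : (fun s => smooth_pos d (peval h (line s))) =
  (fun s => smooth_pos d (peval h x + (peval h (line s) - peval h x))).
  by apply/funext => s; rewrite addrC subrK.
set a := peval h x in hK *; set b := peval _ x in hK *.
have h0 := hypot_gt0 a d0.
exists (K + (`|b| + K) ^+ 2 / (4 * hypot d a)) => s s1.
apply: (le_trans (smooth_pos_parabola _ _ d0)).
have -> : line 0 = x by rewrite /line scale0r addr0.
rewrite -/a subrr addr0 -[leLHS]addrA -[leRHS]addrA lerD2l [X in _ <= _ + X]mulrDl addrA.
have s2 : s ^+ 2 <= `|s|.
  by rewrite -[s ^+ 2]real_normK ?num_real // expr2 ler_piMr.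
have {}hK := hK s s1; set e := peval h (line s) - a in hK *.
have sl0 := smooth_slope_ge0 a d0; have sl1 := smooth_slope_le1 a d0.
have se : e - s * b <= K * s ^+ 2 by apply: le_trans hK; apply: ler_norm.
apply: lerD.
  rewrite -lerBlDl mulrCA -mulrBr; apply: le_trans (ler_wpM2l sl0 se) _.
  by rewrite ler_piMl // mulr_ge0 ?sqr_ge0.
have eb : `|e| <= (`|b| + K) * `|s|.
  have -> : e = (e - s * b) + s * b by rewrite subrK.
  apply: (le_trans (ler_normD _ _)); rewrite addrC mulrDl normrM.
  rewrite [`|s| * _]mulrC lerD2l; apply: (le_trans hK).
  exact: ler_wpM2l.
rewrite [leRHS]mulrAC ler_pM2r ?invr_gt0 ?mulr_gt0 //.
rewrite -[s ^+ 2]real_normK ?num_real // -exprMn -[e ^+ 2]real_normK ?num_real //.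
by rewrite ler_pXn2r // nnegrE // mulr_ge0 // addr_ge0.
Qed.

End Taylor.

(** * The smoothed penalty and its minimizers *)

Section Penalty.
Variables (R : realType) (n m : nat).
Variables (f : {mpoly R[n]}) (g : 'I_m -> {mpoly R[n]}).
Implicit Types (x y : 'rV[R]_n) (c d eps : R).

(** The sum of the positive parts, equivalent to [psi] up to a constant factor
    ([psi_le_pos_sum], [pos_sum_le_psi]), leads to multipliers that are separate
    functions of each constraint. *)
Definition pos_sum x : R := \sum_i Num.max (peval (g i) x) 0.

Definition smoothed c d eps x : R :=
  peval f x + c * (\sum_i smooth_pos d (peval (g i) x)) +
  eps * (\sum_j x 0 j ^+ 2).

Definition multiplier c d x (i : 'I_m) : R :=
  c * smooth_slope d (peval (g i) x).

(** For [0 < d], the gradient of [smoothed c d eps] vanishes at [x]. *)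
Definition stationary c d eps x : Prop := forall j,
  peval (mderiv j f) x +
    \sum_i multiplier c d x i * peval (mderiv j (g i)) x =
  - (2 * eps * x 0 j).

Lemma psi_ge0 x : 0 <= psi g x.
Proof. exact: bigmax_ge_id. Qed.

Lemma pos_sum_ge0 x : 0 <= pos_sum x.
Proof. by apply: sumr_ge0 => i _; rewrite le_max lexx orbT. Qed.

Lemma pos_sum_ge i x : Num.max (peval (g i) x) 0 <= pos_sum x.
Proof.
rewrite /pos_sum (bigD1 i) //= lerDl.
by apply: sumr_ge0 => l _; rewrite le_max lexx orbT.
Qed.

Lemma psi_le_pos_sum x : psi g x <= pos_sum x.
Proof.
apply/bigmax_leP; split=> [|i _]; first exact: pos_sum_ge0.
by apply: le_trans (pos_sum_ge i x); rewrite le_max lexx.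
Qed.

Lemma pos_sum_le_psi x : pos_sum x <= m%:R * psi g x.
Proof.
rewrite mulr_natl -[X in _ *+ X](card_ord m) -sumr_const.
apply: ler_sum => i _; rewrite ge_max psi_ge0 andbT.
exact: (le_bigmax _ (fun i => peval (g i) x)).
Qed.

Lemma feasible_pos_sum x : feasible g x <-> pos_sum x <= 0.
Proof.
split=> [gx|px i].
  by rewrite /pos_sum big1// => i _; apply/max_idPr/gx.
apply: le_trans (le_trans (pos_sum_ge i x) px).
by rewrite le_max lexx.
Qed.

Lemma psi_feasible x : feasible g x -> psi g x = 0.
Proof.
move=> /feasible_pos_sum px; apply/eqP; rewrite eq_le psi_ge0 andbT.
exact: le_trans (psi_le_pos_sum x) px.
Qed.

Lemma psi_le0_feasible x : psi g x <= 0 -> feasible g x.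
Proof.
move=> px; apply/feasible_pos_sum; apply: (le_trans (pos_sum_le_psi x)).
by rewrite mulr_ge0_le0.
Qed.

Lemma smoothed_ge c d eps x : 0 <= c ->
  peval f x + c * pos_sum x + eps * (\sum_j x 0 j ^+ 2) <= smoothed c d eps x.
Proof.
move=> c0; rewrite lerD2r lerD2l ler_wpM2l //; apply: ler_sum => i _.
exact: smooth_pos_ge.
Qed.

Lemma smoothed_le c d eps x : 0 <= c -> 0 < d ->
  smoothed c d eps x <=
  peval f x + c * (pos_sum x + m%:R * d) + eps * (\sum_j x 0 j ^+ 2).
Proof.
move=> c0 d0; rewrite lerD2r lerD2l ler_wpM2l //.
rewrite mulr_natl -[X in _ *+ X](card_ord m) -sumr_const -big_split.
by apply: ler_sum => i _; apply: smooth_pos_le.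
Qed.

Lemma smoothed_cvg (T : Type) (U : set_system T) (u : T -> 'rV[R]_n) x c d eps :
  Filter U -> (forall j, u t 0 j @[t --> U] --> x 0 j) ->
  smoothed c d eps (u t) @[t --> U] --> smoothed c d eps x.
Proof.
move=> FU ux; apply: cvgD; first (apply: cvgD; first exact: peval_cvg).
  apply: cvgM; first exact: cvg_cst.
  by apply: cvgr_sum_seq => i _; apply: smooth_pos_cvg; apply: peval_cvg.
apply: cvgM; first exact: cvg_cst.
by apply: cvgr_sum_seq => j _; apply: cvgrX.
Qed.

Lemma penalty_cvg (T : Type) (U : set_system T) (u : T -> 'rV[R]_n) x c :
  Filter U -> (forall j, u t 0 j @[t --> U] --> x 0 j) ->
  peval f (u t) + c * pos_sum (u t) @[t --> U] --> peval f x + c * pos_sum x.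
Proof.
move=> FU ux.
have E z : peval f z + c * pos_sum z = smoothed c 0 0 z.
  rewrite /smoothed mul0r addr0; congr (_ + c * _).
  by apply: eq_bigr => i _; rewrite smooth_pos0.
by rewrite E; under eq_fun do rewrite E; apply: smoothed_cvg.
Qed.

(** The quadratic term makes the function coercive, so that its minimum on a
    large box is global. *)
Lemma smoothed_minimizer c d eps (C : R) : 0 <= c -> 0 < eps ->
  (forall x, - C <= peval f x + c * pos_sum x) ->
  exists x, forall y, smoothed c d eps x <= smoothed c d eps y.
Proof.
move=> c0 eps0 fC.
pose h := smoothed c d eps; pose b := `|(h 0 + C) / eps| + 1.
have b1 : 1 <= b by rewrite lerDr.
have b0 : 0 <= b by apply: le_trans b1.
have [x _ xmin] : exists2 x, x \in [set v : 'rV[R]_n | forall j, v ord0 j \in `[- b, b]]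
    & forall y, y \in [set v : 'rV[R]_n | forall j, v ord0 j \in `[- b, b]] -> h x <= h y.
  apply: EVT_min_rV.
  - by exists 0 => j; rewrite mxE in_itv /= oppr_le0 b0.
  - by apply: (@rV_compact R n (fun=> `[- b, b]%classic)) => _; apply: segment_compact.
  - apply: continuous_subspaceT => y; apply: (@smoothed_cvg _ (nbhs y) id) => j.
    exact: (@coord_continuous R 1 n 0 j y).
exists x => y.
have [yb|yb] := pselect (forall j, y 0 j \in `[- b, b]).
  by apply: xmin; rewrite inE.
have h0 : h x <= h 0.
  by apply: xmin; rewrite inE => j; rewrite mxE in_itv /= oppr_le0 b0.
apply: (le_trans h0).
have [j /negP yj] : exists j, ~ y 0 j \in `[- b, b] by apply/existsNP.
have {}yj : b < `|y 0 j|.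
  by move: yj; rewrite in_itv /= -ler_norml -ltNge.
(* Outside the box the quadratic term alone exceeds [h 0 + C]. *)
have yb2 : (h 0 + C) / eps <= \sum_j y 0 j ^+ 2.
  apply: (@le_trans _ _ (y 0 j ^+ 2)); last first.
    by rewrite (bigD1 j) //= lerDl; apply: sumr_ge0 => l _; apply: sqr_ge0.
  rewrite -real_normK ?num_real //; apply: (@le_trans _ _ `|y 0 j|).
    by apply: le_trans (ltW yj); apply: le_trans (ler_norm _) _; rewrite lerDl.
  by rewrite expr2 ler_peMl // (le_trans b1) // ltW.
apply: le_trans (smoothed_ge d eps y c0).
rewrite -lerBlDl; apply: (@le_trans _ _ (h 0 + C)).
  by have := fC y; lra.
by rewrite -ler_pdivrMl // mulrC.
Qed.

Lemma smoothed_minimizer_stationary c d eps x : 0 <= c -> 0 < d -> 0 < eps ->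
  (forall y, smoothed c d eps x <= smoothed c d eps y) ->
  stationary c d eps x.
Proof.
move=> c0 d0 eps0 xmin j; apply/eqP; rewrite -subr_eq0 opprK; apply/eqP.
pose line (s : R) : 'rV[R]_n := x + s *: delta_mx 0 j.
have line0 : line 0 = x by rewrite /line scale0r addr0.
apply: (@upper_model_stationary _ (fun s => smoothed c d eps (line s))); last first.
  by move=> s; rewrite line0.
apply: upper_modelD; first apply: upper_modelD.
- exact: peval_upper_model.
- have -> : \sum_i multiplier c d x i * peval (mderiv j (g i)) x =
      c * \sum_i smooth_slope d (peval (g i) x) * peval (mderiv j (g i)) x.
    by rewrite mulr_sumr; apply: eq_bigr => i _; rewrite mulrA.
  apply: upper_modelZ => //; apply: upper_model_sum => i.
  exact: smooth_pos_upper_model.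
have -> : 2 * eps * x 0 j = eps * (2 * x 0 j) by ring.
apply: upper_modelZ; first exact: ltW.
exists 1 => s _; rewrite line0 mul1r (bigD1 j) //= [X in _ <= X + _ + _](bigD1 j) //=.
rewrite !mxE !eqxx mulr1.
rewrite (eq_bigr (fun l => x 0 l ^+ 2)); last first.
  by move=> l lj; rewrite !mxE eqxx (negbTE lj) mulr0 addr0.
by rewrite le_eqVlt; apply/orP; left; apply/eqP; ring.
Qed.

End Penalty.

(** * Minimizers stay in a bounded region *)

Lemma ultra_bounded_cvg_rV (R : realType) (n : nat) (T : Type)
    (U : set_system T) (x : T -> 'rV[R]_n) (r : R) : UltraFilter U ->
  (forall t j, `|x t 0 j| <= r) ->
  exists y : 'rV[R]_n, forall j, x t 0 j @[t --> U] --> y 0 j.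
Proof.
move=> UU xr.
have /choice[y yP] : forall j, exists l : R, x t 0 j @[t --> U] --> l.
  move=> j; have [|l _ xl] := @ultra_bounded_cvg _ R U (fun t => x t 0 j) (- r) r UU.
    by apply: nearW => t; rewrite -ler_norml.
  by exists l.
by exists (\row_j y j) => j; rewrite mxE.
Qed.

Section Bounded.
Variables (R : realType) (n m : nat).
Variables (f : {mpoly R[n]}) (g : 'I_m -> {mpoly R[n]}).
Hypotheses (Fconv : convenient (fcons f g)).
Hypotheses (Fnd : nondegenerate_at_infinity (fcons f g)).
Variables (C c0 : R).
Hypotheses (c0_ge0 : 0 <= c0).
Hypotheses (f_bounded : forall x, - C <= peval f x + c0 * pos_sum g x).

Lemma penalty_bounded c x : c0 <= c -> - C <= peval f x + c * pos_sum g x.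
Proof.
move=> c0c; apply: (le_trans (f_bounded x)).
by rewrite lerD2l ler_wpM2r // pos_sum_ge0.
Qed.

(** The bound [V] on the value controls [f], the sum of positive parts and
    [eps * |x|^2], because the weight [c] exceeds [c0] by at least [1]. These are
    the bounds required of the multipliers [(1, lam_1, ..., lam_m)], uniformly in
    [c], [d] and [eps]. *)
Lemma stationary_points_bounded (V : R) : exists r, forall c d eps x,
  c0 + 1 <= c -> 0 < d -> c * d <= 1 -> 0 < eps ->
  smoothed f g c d eps x <= V -> stationary f g c d eps x ->
  forall j, `|x 0 j| <= r.
Proof.
pose B := (1 + c0) * `|V + C| + 2 * `|V + C| + `|V| + `|C| + 1.
have [r rP] := bounded_multipliers_bounded_points ord0 Fconv Fnd B.
exists r => c d eps x cc0 d0 cd eps0 hV st.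
have c0_0 := c0_ge0; have c_ge0 : 0 <= c by lra.
have P0 := pos_sum_ge0 g x.
have Q0 : 0 <= \sum_j x 0 j ^+ 2 by apply: sumr_ge0 => l _; apply: sqr_ge0.
have eQ0 : 0 <= eps * \sum_j x 0 j ^+ 2 by rewrite mulr_ge0 // ltW.
have hlo := le_trans (smoothed_ge f g d eps x c_ge0) hV.
have fb := f_bounded x.
have VC : `|V + C| = V + C.
  have cP : c0 * pos_sum g x <= c * pos_sum g x by rewrite ler_wpM2r //; lra.
  by rewrite ger0_norm //; lra.
have cP : pos_sum g x <= c * pos_sum g x - c0 * pos_sum g x.
  by rewrite -mulrBl ler_peMl //; lra.
have PV : pos_sum g x <= V + C by lra.
have c0P : c0 * pos_sum g x <= c0 * (V + C) by rewrite ler_wpM2l.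
have c0P0 : 0 <= c0 * pos_sum g x by rewrite mulr_ge0.
have eQV : eps * (\sum_j x 0 j ^+ 2) <= V + C by lra.
have nV := ler_norm V; have nV' := ler_norm (- V); rewrite normrN in nV'.
have nC := ler_norm C; have nC' := ler_norm (- C); rewrite normrN in nC'.
pose lam := fun i : 'I_m.+1 =>
  if unlift ord0 i is Some j then multiplier g c d x j else 1.
have lam_ord0 : lam ord0 = 1 by rewrite /lam unlift_none.
have lam_lift i : lam (lift ord0 i) = multiplier g c d x i by rewrite /lam liftK.
have F_ord0 : fcons f g ord0 = f by rewrite /fcons unlift_none.
have F_lift i : fcons f g (lift ord0 i) = g i by rewrite /fcons liftK.
apply: (rP x lam) => //.
- move=> i; case: (unliftP ord0 i) => [l|] ->; last by rewrite lam_ord0.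
  by rewrite lam_lift mulr_ge0 // smooth_slope_ge0.
- move=> i; case: (unliftP ord0 i) => [l|] ->; last first.
    rewrite lam_ord0 F_ord0 mul1r ler_norml /B VC.
    by apply/andP; split; lra.
  rewrite lam_lift F_lift /multiplier -mulrA normrM (ger0_norm c_ge0).
  apply: (le_trans (ler_wpM2l c_ge0 (ler_norm_smooth_slopeM _ d0))).
  rewrite mulrDr; have := ler_wpM2l c_ge0 (pos_sum_ge g l x).
  by rewrite /B VC; lra.
- move=> l; rewrite big_ord_recl lam_ord0 F_ord0 mul1r.
  under eq_bigr do rewrite lam_lift F_lift.
  rewrite st mulrN normrN.
  have -> : x 0 l * (2 * eps * x 0 l) = 2 * (eps * x 0 l ^+ 2) by ring.
  have e2 : 0 <= eps * x 0 l ^+ 2 by rewrite mulr_ge0 ?sqr_ge0 // ltW.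
  have : eps * x 0 l ^+ 2 <= eps * \sum_j x 0 j ^+ 2.
    rewrite ler_wpM2l ?(ltW eps0) // (bigD1 l) //= lerDl.
    by apply: sumr_ge0 => i _; apply: sqr_ge0.
  have e20 : 0 <= 2 * (eps * x 0 l ^+ 2) by rewrite mulr_ge0.
  rewrite (ger0_norm e20) /B VC.
  have : 0 <= c0 * (V + C) by rewrite mulr_ge0 // -VC.
  have : 0 <= V + C by rewrite -VC.
  lra.
Qed.

(** For small [d] and [eps] the smoothed function is still below [V'] at [y],
    hence at its minimizer, which is the point sought. *)
Lemma stationary_points_below (V : R) : exists r, forall c y V',
  c0 + 1 <= c -> V' <= V -> peval f y + c * pos_sum g y < V' ->
  exists d eps x, [/\ 0 < d, 0 < eps <= 1, stationary f g c d eps x,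
    c * d <= 1 /\ peval f x + c * pos_sum g x < V' & forall j, `|x 0 j| <= r].
Proof.
have [r rP] := stationary_points_bounded V; exists r => c y V' cc0 V'V yV.
have c0_0 := c0_ge0; have c_gt0 : 0 < c by lra.
have c_ge0 := ltW c_gt0.
pose gap := V' - (peval f y + c * pos_sum g y).
have gap0 : 0 < gap by rewrite subr_gt0.
pose Q := \sum_j y 0 j ^+ 2.
have Q0 : 0 <= Q by apply: sumr_ge0 => l _; apply: sqr_ge0.
(* These choices spend at most a third of the gap on each perturbation. *)
pose d := Num.min c^-1 (gap / 3 / (c * (m%:R + 1))).
pose eps := Num.min 1 (gap / 3 / (Q + 1)).
have m1 : 0 < m%:R + 1 :> R by rewrite ltr_wpDl.
have Q1 : 0 < Q + 1 by rewrite ltr_wpDl.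
have d0 : 0 < d by rewrite lt_min invr_gt0 c_gt0 /= !divr_gt0 // mulr_gt0.
have eps0 : 0 < eps by rewrite lt_min ltr01 /= !divr_gt0.
have eps1 : eps <= 1 by rewrite ge_min lexx.
have cd : c * d <= 1.
  by rewrite -ler_pdivlMl // mulr1 ge_min lexx.
have dg : c * (m%:R * d) <= gap / 3.
  have : d <= gap / 3 / (c * (m%:R + 1)) by rewrite ge_min lexx orbT.
  rewrite ler_pdivlMr ?mulr_gt0 //; apply: le_trans.
  have -> : d * (c * (m%:R + 1)) = c * (m%:R * d) + c * d by ring.
  by rewrite lerDl mulr_ge0 // ltW.
have eg : eps * Q <= gap / 3.
  have : eps <= gap / 3 / (Q + 1) by rewrite ge_min lexx orbT.
  rewrite ler_pdivlMr //; apply: le_trans.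
  by rewrite mulrDr mulr1 lerDl ltW.
have [|x xmin] := @smoothed_minimizer _ _ _ f g c d eps C c_ge0 eps0.
  by move=> x; apply: penalty_bounded; lra.
have st := smoothed_minimizer_stationary c_ge0 d0 eps0 xmin.
have xV : smoothed f g c d eps x < V'.
  apply: (le_lt_trans (xmin y)); apply: (le_lt_trans (smoothed_le f g eps y c_ge0 d0)).
  by rewrite mulrDr -/Q; move: dg eg gap0; rewrite /gap; lra.
exists d, eps, x; split=> //.
- by rewrite eps0.
- split=> //; apply: le_lt_trans xV; apply: le_trans (smoothed_ge f g d eps x c_ge0).
  rewrite lerDl mulr_ge0 ?(ltW eps0) //.
  by apply: sumr_ge0 => l _; apply: sqr_ge0.
by apply: (rP c d eps x) => //; apply: le_trans (ltW xV) V'V.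
Qed.


End Bounded.

(** * Attainment and exactness *)

Section Exactness.
Variables (R : realType) (n m : nat).
Variables (f : {mpoly R[n]}) (g : 'I_m -> {mpoly R[n]}).
Hypotheses (Fconv : convenient (fcons f g)).
Hypotheses (Fnd : nondegenerate_at_infinity (fcons f g)).
Variables (C c0 : R).
Hypotheses (c0_ge0 : 0 <= c0).
Hypotheses (f_bounded : forall x, - C <= peval f x + c0 * pos_sum g x).

(** A minimizing family can be chosen among the stationary points of
    [stationary_points_below], which are bounded. *)
Lemma penalty_attained (c : R) : c0 + 1 <= c -> exists x, forall y,
  peval f x + c * pos_sum g x <= peval f y + c * pos_sum g y.
Proof.
move=> cc0; pose h x := peval f x + c * pos_sum g x.
have hlb : has_lbound (range h).
  exists (- C) => _ [x _ <-]; apply: penalty_bounded => //.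
  by apply: le_trans cc0; rewrite lerDl.
have hinf : has_inf (range h) by split=> //; exists (h 0), 0.
pose mu := inf (range h).
have mu_le y : mu <= h y by apply: ge_inf => //; exists y.
have [r rP] := stationary_points_below Fconv Fnd c0_ge0 f_bounded (mu + 1).
have /choice[x xP] : forall k : nat, exists x : 'rV[R]_n,
    h x < mu + k.+1%:R^-1 /\ forall j, `|x 0 j| <= r.
  move=> k; have [|_ [y _ <-] yk] := @inf_adherent R (range h) k.+1%:R^-1 _ hinf.
    by rewrite invr_gt0.
  have [|d [eps [x [_ _ _ [_ hx] xr]]]] := rP c y (mu + k.+1%:R^-1) cc0 _ yk.
    by rewrite lerD2l invf_le1 ?ler1n.
  by exists x.
have [U [UU oU]] := ultraFilterLemma (eventually_filter : ProperFilter \oo).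
have [z xz] := ultra_bounded_cvg_rV UU (fun k => (xP k).2).
exists z => y; apply: le_trans (mu_le y).
apply/ler_addgt0Pr => e e0.
have hz : h (x k) @[k --> U] --> h z by apply: penalty_cvg.
apply: (cvgr_to_le hz).
have : \forall k \near U, k.+1%:R^-1 < e.
  by apply: oU; apply: (near_infty_natSinv_lt (PosNum e0)).
apply: filterS => k ke; apply/ltW; apply: (lt_trans (xP k).1).
by rewrite ltrD2l.
Qed.

(** A failure of exactness for weights tending to infinity produces stationary
    points that are infeasible, so that the sum of the multipliers is at least
    half the weight. The normalized multipliers converge to a nonzero normal
    vector that annihilates the gradients at the limit point, which is feasible
    with value at most [fs]. *)
Lemma exact_for_large_weights (fs : R) :
  (forall x, feasible g x -> fs <= peval f x) ->
  (forall x, feasible g x -> peval f x <= fs -> MFCQ g x) ->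
  exists c1, forall c, c1 <= c -> forall y, fs <= peval f y + c * pos_sum g y.
Proof.
move=> fsS mfcq; apply: contrapT => nc.
have [r rP] := stationary_points_below Fconv Fnd c0_ge0 f_bounded fs.
have /choice[w wP] : forall k : nat, exists w : (R * R) * (R * 'rV[R]_n),
    [/\ k%:R + c0 + 1 <= w.1.1, 0 < w.1.2, w.1.1 * w.1.2 <= 1 &
      0 < w.2.1 <= 1] /\
    [/\ stationary f g w.1.1 w.1.2 w.2.1 w.2.2,
      peval f w.2.2 + w.1.1 * pos_sum g w.2.2 < fs &
      forall j, `|w.2.2 0 j| <= r].
  move=> k; apply: contrapT => nw; apply: nc; exists (k%:R + c0 + 1) => c ck y.
  rewrite leNgt; apply/negP => cy.
  have [|d [eps [x [d0 eps1 st [cd hx] xr]]]] := rP c y fs _ (lexx _) cy.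
    by apply: le_trans ck; rewrite lerD2r lerDr.
  by apply: nw; exists ((c, d), (eps, x)).
pose c k := (w k).1.1; pose d k := (w k).1.2.
pose eps k := (w k).2.1; pose x k := (w k).2.2.
have ck k : k%:R + c0 + 1 <= c k by case: (wP k) => -[].
have d0 k : 0 < d k by case: (wP k) => -[].
have cd k : c k * d k <= 1 by case: (wP k) => -[].
have eps01 k : 0 < eps k <= 1 by case: (wP k) => -[].
have st k : stationary f g (c k) (d k) (eps k) (x k) by case: (wP k) => _ [].
have hx k : peval f (x k) + c k * pos_sum g (x k) < fs by case: (wP k) => _ [].
have xr k j : `|x k 0 j| <= r by case: (wP k) => _ [].
have c00 := c0_ge0.
have kge0 (k : nat) : 0 <= k%:R :> R by rewrite ler0n.
have cgt0 k : 0 < c k by have := ck k; have := kge0 k; lra.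
have cge0 k := ltW (cgt0 k).
have [U [UU oU]] := ultraFilterLemma (eventually_filter : ProperFilter \oo).
have natU (A : R) : \forall k \near U, A <= k%:R.
  by apply: oU; have /cvgryPge := @cvgr_idn R; apply.
have [z xz] := ultra_bounded_cvg_rV UU xr.
(* The weights eventually exceed any [a]. *)
have zfs a : peval f z + a * pos_sum g z <= fs.
  have hz : peval f (x k) + a * pos_sum g (x k) @[k --> U] -->
      peval f z + a * pos_sum g z by apply: penalty_cvg.
  apply: (cvgr_to_le hz).
  apply: filterS (natU a) => k ak; apply: le_trans (ltW (hx k)).
  rewrite lerD2l ler_wpM2r ?pos_sum_ge0 //.
  by have := ck k; lra.
have zS : feasible g z.
  apply/feasible_pos_sum; rewrite leNgt; apply/negP => pz.
  (* This weight would push the value below the lower bound [- C]. *)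
  have := zfs (c0 + (fs + C + 1) / pos_sum g z).
  rewrite mulrDl divfK ?gt_eqF //; have := f_bounded z; lra.
have fz : peval f z <= fs by have := zfs 0; rewrite mul0r addr0.
apply: (mfcq z zS fz).
pose lam k i := multiplier g (c k) (d k) (x k) i.
have lam0 k i : 0 <= lam k i by rewrite mulr_ge0 ?smooth_slope_ge0.
pose Lam k := \sum_i lam k i.
(* Some constraint is violated, and its slope is at least one half. *)
have LamE k : c k / 2 <= Lam k.
  have [i gi] : exists i, ~ (peval (g i) (x k) <= 0).
    apply/existsNP => xS; have := fsS _ xS; have := hx k.
    have /feasible_pos_sum px : feasible g (x k) := xS.
    have p0 : pos_sum g (x k) = 0 by apply/eqP; rewrite eq_le px pos_sum_ge0.
    by rewrite p0 mulr0; lra.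
  move: gi => /negP; rewrite -ltNge => gi.
  rewrite /Lam (bigD1 i) //=; apply: (@le_trans _ _ (lam k i)); last first.
    by rewrite lerDl; apply: sumr_ge0.
  rewrite /lam /multiplier ler_wpM2l //.
  by have := smooth_slope_ge_half (d0 k) (ltW gi); lra.
have Lam_gt0 k : 0 < Lam k by have := LamE k; have := cgt0 k; lra.
have Lam_inf : Lam k @[k --> U] --> +oo.
  apply/cvgryPge => A; apply: filterS (natU (2 * A)) => k kA.
  by have := LamE k; have := ck k; lra.
have Lam_inv : (Lam k)^-1 @[k --> U] --> 0.
  by apply/gtr0_cvgV0 => //; apply: nearW.
have /choice[om omP] : forall i, exists l : R,
    0 <= l /\ lam k i / Lam k @[k --> U] --> l.
  move=> i; have [|l /andP[l0 _] ll] :=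
    @ultra_bounded_cvg _ R U (fun k => lam k i / Lam k) 0 1 UU; last by exists l.
  apply: nearW => k; rewrite divr_ge0 ?(ltW (Lam_gt0 k)) //=.
  rewrite ler_pdivrMr // mul1r /Lam (bigD1 i) //= lerDl.
  exact: sumr_ge0.
have om_sum : \sum_i om i = 1.
  apply: (@cvg_unique _ (@Rhausdorff R) (\sum_i lam k i / Lam k @[k --> U])).
    by apply: cvgr_sum_seq => i _; case: (omP i).
  have sum1 k : \sum_i lam k i / Lam k = 1.
    by rewrite -mulr_suml -/(Lam k) divff // gt_eqF.
  by rewrite /=; under eq_fun do rewrite sum1; apply: cvg_cst.
have om_grad j : \sum_i om i * peval (mderiv j (g i)) z = 0.
  apply: (@cvg_unique _ (@Rhausdorff R)
    (\sum_i lam k i / Lam k * peval (mderiv j (g i)) (x k) @[k --> U])).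
    apply: cvgr_sum_seq => i _; apply: cvgM; first by case: (omP i).
    exact: peval_cvg.
  have stE k : \sum_i lam k i / Lam k * peval (mderiv j (g i)) (x k) =
      - (peval (mderiv j f) (x k) * (Lam k)^-1) -
      2 * eps k * x k 0 j * (Lam k)^-1.
    under eq_bigr do rewrite mulrAC.
    rewrite -mulr_suml -mulNr -mulrBl; congr (_ * _).
    by rewrite -(st k j) addrA addNr add0r.
  rewrite /=; under eq_fun do rewrite stE.
  have -> : nbhs (0 : R) = nbhs (- (peval (mderiv j f) z * 0) - 0).
    by rewrite mulr0 oppr0 addr0.
  apply: cvgB; first by apply: cvgN; apply: cvgM => //; apply: peval_cvg.
  apply: (@bounded_cvg0M _ _ _ _ _ (2 * r)) => //; apply: nearW => k.
  have /andP[e0 e1] := eps01 k.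
  rewrite !normrM (ger0_norm (ltW e0)) ger0_norm // -mulrA ler_wpM2l //.
  by apply: le_trans (xr k j); rewrite ler_piMl.
have om_compl i : om i * peval (g i) z = 0.
  apply: (@cvg_unique _ (@Rhausdorff R)
    (lam k i / Lam k * peval (g i) (x k) @[k --> U])).
    by apply: cvgM; [case: (omP i)|apply: peval_cvg].
  rewrite /=; under eq_fun do rewrite mulrAC.
  apply: (@bounded_cvg0M _ _ _ _ _ ((1 + c0) * (fs + C) + 1)) => //.
  apply: nearW => k; rewrite /lam /multiplier -mulrA normrM (ger0_norm (cge0 k)).
  apply: (le_trans (ler_wpM2l (cge0 k) (ler_norm_smooth_slopeM _ (d0 k)))).
  rewrite mulrDr lerD //.
  apply: (le_trans (ler_wpM2l (cge0 k) (pos_sum_ge g i (x k)))).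
  have P0 := pos_sum_ge0 g (x k).
  have P1 : pos_sum g (x k) <= c k * pos_sum g (x k) - c0 * pos_sum g (x k).
    by rewrite -mulrBl ler_peMl //; have := ck k; have := kge0 k; lra.
  have fb := f_bounded (x k); have hk := hx k.
  have P2 : pos_sum g (x k) <= fs + C by lra.
  by have := ler_wpM2l c00 P2; lra.
(* The weights [om] sum to [1]; rescale to Euclidean norm [1]. *)
pose N := \sum_i om i ^+ 2.
have N0 : 0 < N.
  have N_ge0 : 0 <= N by apply: sumr_ge0 => i _; apply: sqr_ge0.
  rewrite lt_def N_ge0 andbT; apply/eqP => N0.
  have : \sum_i om i = 0.
    apply: big1 => i _; apply/eqP; rewrite -sqrf_eq0; apply/eqP.
    by apply: (psumr_eq0P _ N0) => // l _; apply: sqr_ge0.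
  by rewrite om_sum => /eqP; rewrite oner_eq0.
have sN0 : 0 < Num.sqrt N by rewrite sqrtr_gt0.
exists (\row_i (om i / Num.sqrt N)); split.
- under eq_bigr do rewrite mxE expr_div_n.
  by rewrite -mulr_suml sqr_sqrtr ?(ltW N0) // divff // gt_eqF.
- move=> i; rewrite !mxE; split; first by rewrite divr_ge0 ?(ltW sN0) //; case: (omP i).
  by rewrite mulrAC om_compl mul0r.
apply/rowP => j; rewrite summxE mxE.
rewrite (eq_bigr (fun i => (Num.sqrt N)^-1 * (om i * peval (mderiv j (g i)) z))).
  by rewrite -mulr_sumr om_grad mulr0.
by move=> i _; rewrite !mxE mulrA [(Num.sqrt N)^-1 * _]mulrC.
Qed.

End Exactness.

(** * Extended-real infima *)

Section Infima.
Variables (R : realType) (n : nat).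
Implicit Types (A : set 'rV[R]_n) (h : 'rV[R]_n -> R).

Lemma inf_on_le A h x : A x -> (inf_on A h <= (h x)%:E)%E.
Proof. by move=> Ax; apply: ereal_inf_lbound; exists x. Qed.

Lemma le_inf_on A h b : (forall x, A x -> (b <= (h x)%:E)%E) ->
  (b <= inf_on A h)%E.
Proof. by move=> bh; apply: le_ereal_inf_tmp => _ [x Ax <-]; apply: bh. Qed.

Lemma inf_on_gtNy h : (-oo < inf_on setT h)%E -> exists C, forall x, - C <= h x.
Proof.
case E : (inf_on setT h) => [r| |] // _.
  by exists (- r) => x; rewrite opprK -lee_fin -E; apply: inf_on_le.
by have := @inf_on_le setT h 0 I; rewrite E leye_eq.
Qed.

End Infima.

(** * Exact penalization *)

Theorem theorem6p3 (R : realType) (n m : nat)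
    (f : {mpoly R[n]}) (g : 'I_m -> {mpoly R[n]})
    (hmn : (m + 1 <= n)%N)
    (hS : feasible g !=set0)
    (hinf : inf_on (feasible g) (peval f) \is a fin_num)
    (hconv : convenient (fcons f g))
    (hnd : nondegenerate_at_infinity (fcons f g))
    (hmfcq : forall x, argmin (feasible g) (peval f) x -> MFCQ g x) :
  let exact_penalty (cs : R) := forall c : R, cs < c ->
    inf_on (feasible g) (peval f) = inf_on setT (penalized f g c) /\
    (-oo < inf_on setT (penalized f g c))%E in
  ((exists2 cs : R, 0 < cs & exact_penalty cs) <->
   (exists2 cs : R, 0 < cs & (-oo < inf_on setT (penalized f g cs))%E)) /\
  (forall cs : R, 0 < cs -> exact_penalty cs ->
    forall c : R, cs < c ->
      argmin (feasible g) (peval f) = argmin setT (penalized f g c) /\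
      argmin setT (penalized f g c) !=set0).
Proof.
set fs := fine (inf_on (feasible g) (peval f)).
have fsE : inf_on (feasible g) (peval f) = fs%:E by rewrite fineK.
have fsS x : feasible g x -> fs <= peval f x.
  by move=> Sx; rewrite -lee_fin -fsE; apply: inf_on_le.
have penS c x : feasible g x -> penalized f g c x = peval f x.
  by move=> Sx; rewrite /penalized psi_feasible // mulr0 addr0.
have psi_sum c x : 0 <= c -> penalized f g c x <= peval f x + c * pos_sum g x.
  by move=> c0; rewrite lerD2l ler_wpM2l // psi_le_pos_sum.
move=> exact_penalty; split; [split|].
- move=> [cs cs0 ex]; exists (cs + 1); first by rewrite addr_gt0.
  by have [|] := ex (cs + 1); rewrite ?ltrDl.
- move=> [c0 c0_gt0 /inf_on_gtNy[C pC]].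
  have c0_ge0 := ltW c0_gt0.
  have fC x : - C <= peval f x + c0 * pos_sum g x.
    by apply: le_trans (pC x) (psi_sum _ _ c0_ge0).
  have [|c1 c1P] := exact_for_large_weights hconv hnd c0_ge0 fC fsS.
    move=> x Sx xfs; apply: hmfcq; split=> // y Sy.
    exact: le_trans xfs (fsS y Sy).
  (* Passing from the sum of positive parts to [psi] costs a factor [m]. *)
  pose c2 := Num.max c1 1.
  have c2_1 : c1 <= c2 by rewrite le_max lexx.
  have c2_gt0 : 0 < c2 by rewrite lt_max ltr01 orbT.
  exists (c2 * (m%:R + 1)); first by rewrite mulr_gt0 // ltr_wpDl.
  move=> c cc2.
  have fsP y : fs <= penalized f g c y.
    apply: (le_trans (c1P c2 c2_1 y)); rewrite lerD2l.
    apply: (le_trans (ler_wpM2l (ltW c2_gt0) (pos_sum_le_psi g y))).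
    rewrite mulrA ler_wpM2r ?psi_ge0 //; apply: le_trans (ltW cc2).
    by rewrite ler_wpM2l ?(ltW c2_gt0) // lerDl.
  have lefs : (fs%:E <= inf_on setT (penalized f g c))%E.
    by apply: le_inf_on => x _; rewrite lee_fin.
  split; last by apply: lt_le_trans lefs; apply: ltNyr.
  apply/eqP; rewrite eq_le fsE lefs /= -fsE; apply: le_inf_on => x Sx.
  by rewrite -(penS c) //; apply: inf_on_le.
move=> cs cs0 ex c csc.
have fsP c' y : cs < c' -> fs <= penalized f g c' y.
  by move=> /ex[e _]; rewrite -lee_fin -fsE e; apply: inf_on_le.
have argminE : argmin (feasible g) (peval f) = argmin setT (penalized f g c).
  apply/seteqP; split=> x [Sx xmin].
    split=> // y _; rewrite penS //; apply: le_trans (fsP c y csc).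
    rewrite -lee_fin -fsE; apply: le_inf_on => z Sz.
    by rewrite lee_fin; apply: xmin.
  have xfs : penalized f g c x <= fs.
    rewrite -lee_fin -fsE; apply: le_inf_on => z Sz.
    by rewrite lee_fin -(penS c) //; apply: xmin.
  have Fx : feasible g x.
    apply: psi_le0_feasible.
    (* Exactness at a weight strictly between [cs] and [c] leaves a positive
       multiple of [psi] to be paid at [c]. *)
    have [lo hi] := midf_lt csc.
    have := fsP _ x lo; rewrite /penalized => xlo.
    have gap : 0 < c - (cs + c) / 2 by rewrite subr_gt0.
    by rewrite -(pmulr_rle0 _ gap) mulrBl; move: xlo xfs; rewrite /penalized; lra.
  by split=> // y Sy; rewrite -(penS c x) // -(penS c y) //; apply: xmin.
split=> //; rewrite -argminE.
have c'0 : 0 <= cs + 1 by lra.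
have fC x : - - fs <= peval f x + (cs + 1) * pos_sum g x.
  rewrite opprK; apply: le_trans (psi_sum _ _ c'0).
  by apply: fsP; rewrite ltrDl.
have [x xmin] := penalty_attained hconv hnd c'0 fC (lexx _).
have xfs : peval f x + (cs + 1 + 1) * pos_sum g x <= fs.
  rewrite -lee_fin -fsE; apply: le_inf_on => z Sz; rewrite lee_fin.
  apply: (le_trans (xmin z)).
  have := feasible_pos_sum g z; move=> [/(_ Sz) pz _].
  have -> : pos_sum g z = 0 by apply/eqP; rewrite eq_le pz pos_sum_ge0.
  by rewrite mulr0 addr0.
have Sx : feasible g x by apply/feasible_pos_sum; have := fC x; lra.
exists x; split=> // y Sy; apply: le_trans (fsS y Sy).
by have := pos_sum_ge0 g x; have := fC x; move: xfs; nra.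
Qed.
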